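(* Let $n\ge3$, $\nu\in\mathbb{S}^{n-1}$, $\gamma_0>0$, and suppose that $V\in e^{-\gamma_0|w|}L^\infty(\mathbb{R}^n)$. Let $\gamma>0$ be arbitrary, let $\gamma_1$ satisfy $0<\gamma_1\le\gamma$ and $2\gamma_1<\gamma_0$, and let $U$, $\mathcal{G}_0$, $\mathcal{E}$ and $\mathcal{G}$ be the objects, relative to $\gamma_1$, $\nu$ and $V$, described in the context. Set $$v_{z,\rho_\perp}=-\mathcal{G}(z,\rho_\perp)V .$$ Then $$((\mathbb{C}\setminus\mathbb{R})\times U)\setminus\mathcal{E}\ni(z,\rho_\perp)\mapsto v_{z,\rho_\perp}$$ is an analytic function with values in $e^{\gamma|w|}L^2(\mathbb{R}^n)$.
   Context: Write $\langle w\rangle=(1+|w|^2)^{1/2}$. For $s\in\mathbb{R}$, $e^{s|w|}L^p=\{u:e^{-s|w|}u\in L^p(\mathbb{R}^n)\}$; $e^{s\langle w\rangle}L^2=L^2(\mathbb{R}^n;e^{-2s\langle w\rangle}dw)=e^{s|w|}L^2$ with equivalent norms; $e^{s\langle w\rangle}H^m=\{u\in e^{s\langle w\rangle}L^2:D^\alpha u\in e^{s\langle w\rangle}L^2,\ |\alpha|\le m\}$. $\mathrm{span}\{\nu\}^\perp\subset\mathbb{R}^n$ is identified with $\mathbb{R}^{n-1}$, its complexification with $\mathbb{C}^{n-1}$. For $z\in\mathbb{C}\setminus\mathbb{R}$, $\rho_\perp\in\mathbb{R}^{n-1}\setminus\{0\}$ and $\rho=z\nu+\rho_\perp$, set $G_0(\rho)=\mathcal{F}^{-1}(|\xi|^2+2\rho\cdot\xi)^{-1}\mathcal{F}$,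 with $\mathcal{F}$ the Fourier transform on $\mathbb{R}^n$. Objects relative to $\gamma_1$, $\nu$, $V$: $U$ is a neighborhood of $\mathbb{R}^{n-1}\setminus\{0\}$ in $\mathbb{C}^{n-1}$ and $\mathcal{G}_0(z,\rho_\perp):e^{-\gamma_1\langle w\rangle}L^2\to e^{\gamma_1\langle w\rangle}H^2$ is a family of bounded operators, holomorphic in operator norm on $(\mathbb{C}\setminus\mathbb{R})\times U$, with $\mathcal{G}_0(z,\rho_\perp)=G_0(z\nu+\rho_\perp)$ for $(z,\rho_\perp)\in(\mathbb{C}\setminus\mathbb{R})\times(\mathbb{R}^{n-1}\setminus\{0\})$ (the paper proves that such $U$ and $\mathcal{G}_0$ exist). The exceptional set $\mathcal{E}\subset(\mathbb{C}\setminus\mathbb{R})\times U$ is the set of $(z,\rho_\perp)$ for which $\mathrm{Id}+V\mathcal{G}_0(z,\rho_\perp)$ is not invertible on $e^{-\gamma_1|w|}L^2$ (the zero set of an analytic function). Off $\mathcal{E}$, $$\mathcal{G}(z,\rho_\perp)=\mathcal{G}_0(z,\rho_\perp)(\mathrm{Id}+V\mathcal{G}_0(z,\rho_\perp))^{-1}.$$ *)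

(* Defs.v *)
From HB Require Import structures.
From mathcomp Require Import all_boot all_order all_algebra.
From mathcomp Require Import all_classical all_reals all_analysis.
From mathcomp Require Import measurable_realfun complex.

Set Implicit Arguments.
Unset Strict Implicit.
Unset Printing Implicit Defensive.

Import Order.TTheory GRing.Theory Num.Theory.
Import numFieldNormedType.Exports.
Import ComplexField.Normc.

Local Open Scope classical_set_scope.
Local Open Scope ring_scope.
Local Open Scope complex_scope.

Local Notation Re := complex.Re.
Local Notation Im := complex.Im.

Section measurable_rV.
Context {d} {T : measurableType d} (n : nat).

Let coors : 'I_n -> 'rV[T]_n -> T := fun i w => w ord0 i.

Let rV_set0 : g_sigma_preimage coors set0.
Proof. exact: sigma_algebra0. Qed.

Let rV_setC A : g_sigma_preimage coors A -> g_sigma_preimage coors (~` A).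
Proof. exact: sigma_algebraC. Qed.

Let rV_bigcup (F : _^nat) : (forall i, g_sigma_preimage coors (F i)) ->
  g_sigma_preimage coors (\bigcup_i (F i)).
Proof. exact: sigma_algebra_bigcup. Qed.

HB.instance Definition _ := @isMeasurable.Build (measure_tuple_display d)
  'rV[T]_n (g_sigma_preimage coors) rV_set0 rV_setC rV_bigcup.

Lemma measurable_rV_coord (i : 'I_n) :
  measurable_fun [set: 'rV[T]_n] (fun w : 'rV[T]_n => w ord0 i).
Proof.
move=> _ Y mY; rewrite setTI; apply: sub_sigma_algebra => /=.
rewrite -bigcup_seq/=; exists i => /=; first by rewrite mem_index_enum.
by exists Y => //; rewrite setTI.
Qed.

Lemma measurable_fun_rV d1 (T1 : measurableType d1) (f : T1 -> 'rV[T]_n) :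
  (forall i, measurable_fun [set: T1] (fun x => f x ord0 i)) ->
  measurable_fun [set: T1] f.
Proof.
move=> mf.
suff : g_sigma_preimage (fun i => coors i \o f) `<=` measurable.
  rewrite g_sigma_preimage_comp => H _ A mA; rewrite setTI.
  by apply: H; exists A => //; rewrite setTI.
apply: smallest_sub; first exact: sigma_algebra_measurable.
rewrite -bigcup_seq => A [i _] [B mB <-]; exact: (mf i).
Qed.

End measurable_rV.

Section lebesgue_rV.
Variable R : realType.

Definition consrV n (p : 'rV[R]_n * measurableTypeR R) : 'rV[R]_n.+1 :=
  \row_i oapp (fun j => p.1 ord0 j) p.2 (unlift ord0 i).

Lemma measurable_consrV n :
  measurable_fun [set: 'rV[R]_n * measurableTypeR R] (@consrV n).
Proof.
apply: measurable_fun_rV => i; rewrite /consrV.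
case: (unliftP ord0 i) => [j|] ->.
  under eq_fun do rewrite mxE liftK /=.
  exact: (measurableT_comp (@measurable_rV_coord _ R n j)).
under eq_fun do rewrite mxE unlift_none /=.
exact: measurable_snd.
Qed.

Definition lebesgue_rVS n (mu : {measure set 'rV[R]_n -> \bar R}) :
    {measure set 'rV[R]_n.+1 -> \bar R} :=
  measure_function_pushforward__canonical__measure_function_Measure
    (mu \x @lebesgue_measure R)%E (@measurable_consrV n).

Fixpoint lebesgue_rV n : {measure set 'rV[R]_n -> \bar R} :=
  if n is m.+1 then lebesgue_rVS (lebesgue_rV m) else dirac (0 : 'rV[R]_0).

End lebesgue_rV.

Section complex_functions.
Variables (R : realType) (n : nat).
Local Notation C := R[i]^o.
Local Notation Rn := 'rV[R]_n.
Local Notation leb := (lebesgue_rV R n).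
Implicit Types (f g u v : Rn -> C) (w xi : Rn) (s : R).

Definition cmeasurable f :=
  measurable_fun [set: Rn] (fun w => Re (f w)) /\
  measurable_fun [set: Rn] (fun w => Im (f w)).

Definition cintegrable f :=
  leb.-integrable [set: Rn] (fun w => (Re (f w))%:E) /\
  leb.-integrable [set: Rn] (fun w => (Im (f w))%:E).

Definition cintegral f : R[i] :=
  (\int[leb]_w Re (f w)) +i* (\int[leb]_w Im (f w)).

Definition dot w xi : R := \sum_i w ord0 i * xi ord0 i.
Definition eucl w : R := Num.sqrt (dot w w).
Definition japanese w : R := Num.sqrt (1 + eucl w ^+ 2).

Definition in_Lp (p : \bar R) f :=
  cmeasurable f /\ ('N[leb]_p[EFin \o (@normc R \o f)] < +oo)%E.

(* The exponential weights are [k = s * eucl] and [k = s * japanese]. *)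
Definition weighted (k : Rn -> R) f : Rn -> C :=
  fun w => (expR (- k w))%:C * f w.

Definition in_expLp (p : \bar R) (k : Rn -> R) f := in_Lp p (weighted k f).

Definition eucl_weight s : Rn -> R := fun w => s * eucl w.
Definition japanese_weight s : Rn -> R := fun w => s * japanese w.

Definition ae_eqc f g := {ae leb, forall w, f w = g w}.

End complex_functions.

Section expL2.
Variables (R : realType) (n : nat) (k : 'rV[R]_n -> R).
Local Notation C := R[i]^o.
Local Notation Rn := 'rV[R]_n.
Local Notation leb := (lebesgue_rV R n).
Implicit Types (f g : Rn -> C).

Definition expL2fun_norm f : \bar R :=
  ('N[leb]_2%:E[EFin \o (@normc R \o weighted k f)])%E.

Lemma normcD (a b : R[i]) : normc (a + b) <= normc a + normc b.
Proof.
have := ler_normD a b; rewrite !normc_def -rmorphD /= lecR.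
by case: a b => [a1 a2] [b1 b2].
Qed.

Lemma cmeasurableD f g : cmeasurable f -> cmeasurable g -> cmeasurable (f + g).
Proof.
move=> [f1 f2] [g1 g2]; split.
- rewrite (_ : (fun _ => _) = (fun w => Re (f w)) \+ (fun w => Re (g w))).
    exact: measurable_funD.
  by apply/funext => w /=; rewrite fctE; case: (f w) (g w) => [? ?] [].
- rewrite (_ : (fun _ => _) = (fun w => Im (f w)) \+ (fun w => Im (g w))).
    exact: measurable_funD.
  by apply/funext => w /=; rewrite fctE; case: (f w) (g w) => [? ?] [].
Qed.

Lemma cmeasurableZ (a : R[i]) f : cmeasurable f -> cmeasurable (a *: f).
Proof.
move=> [f1 f2]; case: a => a b; split.
- rewrite (_ : (fun _ => _) =
      (fun w => a * Re (f w)) \- (fun w => b * Im (f w))).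
    by apply: measurable_funB; exact: measurable_funM.
  by apply/funext => w /=; rewrite fctE; case: (f w).
- rewrite (_ : (fun _ => _) =
      (fun w => a * Im (f w)) \+ (fun w => b * Re (f w))).
    by apply: measurable_funD; exact: measurable_funM.
  by apply/funext => w /=; rewrite fctE; case: (f w).
Qed.

Lemma measurable_normc f : cmeasurable f ->
  measurable_fun [set: Rn] (fun w => normc (f w)).
Proof.
move=> [f1 f2].
rewrite (_ : (fun _ => _) =
    (fun w => Num.sqrt (Re (f w) ^+ 2 + Im (f w) ^+ 2))).
  apply: (measurableT_comp (continuous_measurable_fun (@sqrt_continuous R))).
  by apply: measurable_funD; exact: measurable_funX.
by apply/funext => w; case: (f w).
Qed.


Lemma weightedD f g : weighted k (f + g) = weighted k f + weighted k g.
Proof. by apply/funext => w; rewrite /weighted !fctE mulrDr. Qed.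

Lemma weightedZ (a : R[i]) f : weighted k (a *: f) = a *: weighted k f.
Proof. by apply/funext => w; rewrite /weighted !fctE; exact: mulrCA. Qed.

Let cabs f : Rn -> R := @normc R \o f.

Let L2normE (h : Rn -> R) :
  ('N[leb]_2%:E[EFin \o h] = (\int[leb]_w ((`|h w| ^+ 2)%:E)) `^ 2^-1)%E.
Proof.
rewrite unlock /Lnorm; congr (_ `^ _)%E; apply: eq_integral => w _ /=.
by rewrite -powR_mulrn.
Qed.

Lemma normc_ge0 (z : R[i]) : 0 <= normc z.
Proof. by case: z => a b; exact: sqrtr_ge0. Qed.

Let L2normD f g : cmeasurable f -> cmeasurable g ->
  ('N[leb]_2%:E[EFin \o cabs (f + g)%R] <=
   'N[leb]_2%:E[EFin \o cabs f] + 'N[leb]_2%:E[EFin \o cabs g])%E.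
Proof.
move=> mf mg; have nf := measurable_normc mf; have ng := measurable_normc mg.
apply: (le_trans _ (@minkowski_EFin _ _ _ leb _ _ 2 nf ng _)); last first.
  by rewrite ler1n.
rewrite !L2normE; apply: gt0_ler_poweR.
- by rewrite invr_ge0.
- by rewrite in_itv/= leey andbT; apply: integral_ge0 => w _.
- by rewrite in_itv/= leey andbT; apply: integral_ge0 => w _.
apply: ge0_le_integral => //.
- apply/measurable_EFinP/measurable_funX/measurableT_comp => //.
  by apply: measurable_normc; exact: cmeasurableD.
- apply/measurable_EFinP/measurable_funX/measurableT_comp => //.
  exact: measurable_funD.
- move=> w _; rewrite lee_fin lerXn2r// ?nnegrE//= ger0_norm ?normc_ge0//.
  by rewrite ger0_norm ?addr_ge0 ?normc_ge0// normcD.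
Qed.

Let L2normZ (a : R[i]) f : cmeasurable f ->
  ('N[leb]_2%:E[EFin \o cabs (a *: f)%R] =
   (normc a)%:E * 'N[leb]_2%:E[EFin \o cabs f])%E.
Proof.
move=> mf; rewrite !L2normE.
under eq_integral.
  move=> w _; rewrite /cabs /= fctE normcM normrM exprMn EFinM.
  rewrite (ger0_norm (normc_ge0 a)).
  over.
rewrite ge0_integralZl//; last 2 first.
- apply/measurable_EFinP/measurable_funX/measurableT_comp => //.
  exact: measurable_normc.
- by rewrite lee_fin sqr_ge0.
rewrite poweRM ?lee_fin ?sqr_ge0 ?integral_ge0//.
congr (_ * _)%E.
by rewrite poweR_EFin -powR_mulrn ?normc_ge0// -powRrM mulfV// powRr1 ?normc_ge0.
Qed.

Let L2norm_ae f g : cmeasurable f -> cmeasurable g -> ae_eqc f g ->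
  ('N[leb]_2%:E[EFin \o cabs f] = 'N[leb]_2%:E[EFin \o cabs g])%E.
Proof.
move=> mf mg fg; rewrite !L2normE; congr (_ `^ _)%E.
apply: ae_eq_integral => //.
- apply/measurable_EFinP/measurable_funX/measurableT_comp => //.
  exact: measurable_normc.
- apply/measurable_EFinP/measurable_funX/measurableT_comp => //.
  exact: measurable_normc.
- by apply: filterS fg => w fgw _; rewrite /cabs /= fgw.
Qed.

Lemma expL2fun_normD f g : in_expLp 2%:E k f -> in_expLp 2%:E k g ->
  (expL2fun_norm (f + g)%R <= expL2fun_norm f + expL2fun_norm g)%E.
Proof.
by move=> [mf _] [mg _]; rewrite /expL2fun_norm weightedD; exact: L2normD.
Qed.

Lemma expL2fun_normZ (a : R[i]) f : in_expLp 2%:E k f ->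
  (expL2fun_norm (a *: f)%R = (normc a)%:E * expL2fun_norm f)%E.
Proof.
by move=> [mf _]; rewrite /expL2fun_norm weightedZ; exact: L2normZ.
Qed.

Lemma expL2fun_norm_ae f g : in_expLp 2%:E k f -> in_expLp 2%:E k g ->
  ae_eqc f g -> expL2fun_norm f = expL2fun_norm g.
Proof.
move=> [mf _] [mg _] fg; apply: L2norm_ae => //.
by apply: filterS fg => w; rewrite /weighted => ->.
Qed.

Lemma expL2fun_norm_eq0 f : in_expLp 2%:E k f -> expL2fun_norm f = 0%E ->
  ae_eqc f 0.
Proof.
move=> [mf _] /Lnorm_eq0_eq0 -/(_ _ _) h.
apply: filterS (h _ _) => //; last first.
  by apply/measurable_EFinP; exact: measurable_normc.
move=> w /= /(_ I) [] /eq0_normc /eqP.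
rewrite /weighted mulf_eq0 => /orP[|/eqP//].
by rewrite eq_complex /= eqxx andbT gt_eqF ?expR_gt0.
Qed.

Lemma in_expL2_0 : in_expLp 2%:E k 0.
Proof.
have -> : in_expLp 2%:E k 0 = in_Lp 2%:E (0 : Rn -> C).
  by congr in_Lp; apply/funext => w; rewrite /weighted mulr0.
split; first by split; exact: measurable_cst.
rewrite (_ : EFin \o _ = cst 0%E) ?Lnorm0//.
by apply/funext => w; congr EFin; exact: normc0.
Qed.

Definition expL2_pred : {pred Rn -> C} := [pred f | `[< in_expLp 2%:E k f >]].

Lemma expL2P f : reflect (in_expLp 2%:E k f) (f \in expL2_pred).
Proof. exact: asboolP. Qed.

Lemma expL2_submod_closed : submod_closed expL2_pred.
Proof.
split=> [|a f g]; first by apply/expL2P; exact: in_expL2_0.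
move=> /expL2P Lf /expL2P Lg; apply/expL2P.
have Laf : in_expLp 2%:E k (a *: f).
  split; first by rewrite weightedZ; apply: cmeasurableZ; case: Lf.
  rewrite -/(expL2fun_norm _) expL2fun_normZ//; apply: lte_mul_pinfty => //.
  - by rewrite lee_fin normc_ge0.
  - by case: Lf.
split; first by rewrite weightedD; apply: cmeasurableD; [case: Laf|case: Lg].
rewrite -/(expL2fun_norm _) (le_lt_trans (expL2fun_normD Laf Lg))// lte_add_pinfty//.
- by case: Laf.
- by case: Lg.
Qed.

HB.instance Definition _ := GRing.isSubmodClosed.Build _ _ expL2_pred
  expL2_submod_closed.

Record expL2fun := ExpL2fun {
  expL2fun_val :> Rn -> C ;
  expL2fun_mem : expL2fun_val \in expL2_pred }.

HB.instance Definition _ := [isSub for expL2fun_val].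
HB.instance Definition _ := [Choice of expL2fun by <:].
HB.instance Definition _ := [SubChoice_isSubLmodule of expL2fun by <:].

Definition expL2_null : {pred expL2fun} := 
  [pred f : expL2fun | `[< ae_eqc f 0 >]].

Lemma expL2_nullP (f : expL2fun) : reflect (ae_eqc f 0) (f \in expL2_null).
Proof. exact: asboolP. Qed.

Lemma expL2_null_submod_closed : submod_closed expL2_null.
Proof.
split=> [|a f g]; first by apply/expL2_nullP; exact/nearW.
move=> /expL2_nullP f0 /expL2_nullP g0; apply/expL2_nullP.
apply: filterS2 f0 g0 => w fw0 gw0.
by change (a * f w + g w = 0); rewrite fw0 gw0 mulr0 addr0.
Qed.

HB.instance Definition _ := GRing.isSubmodClosed.Build _ _ expL2_null
  expL2_null_submod_closed.


Definition expL2 : Type := Quotient.quot expL2_null.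
HB.instance Definition _ := GRing.Zmodule.on expL2.
HB.instance Definition _ := EqQuotient.on expL2.

Local Open Scope quotient_scope.

Definition expL2_fun (u : expL2) : Rn -> C := repr u.

Lemma expL2_piP (f g : expL2fun) :
  \pi_expL2 f = \pi_expL2 g <-> ae_eqc f g.
Proof.
have -> : (\pi_expL2 f = \pi_expL2 g) <-> (f - g \in expL2_null).
  by rewrite Quotient.idealrBE; split=> [->//|/eqP].
split=> [/expL2_nullP|fg].
  apply: filterS => w fgw; apply/eqP; rewrite -subr_eq0; apply/eqP.
  exact: fgw.
apply/expL2_nullP; apply: filterS fg => w fgw.
by change (f w - g w = 0); rewrite fgw subrr.
Qed.

Lemma expL2_repr_pi (f : expL2fun) : ae_eqc (repr (\pi_expL2 f)) f.
Proof. by apply/expL2_piP; rewrite reprK. Qed.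

Definition expL2_scale (a : R[i]) (u : expL2) : expL2 :=
  \pi_expL2 (a *: (repr u : expL2fun)).

Lemma pi_expL2_scale a (f : expL2fun) :
  expL2_scale a (\pi_expL2 f) = \pi_expL2 (a *: f).
Proof.
apply/expL2_piP; apply: filterS (expL2_repr_pi f) => w fw.
by change (a * (repr (\pi_expL2 f) : expL2fun) w = a * f w); rewrite fw.
Qed.

Lemma pi_expL2D (f g : expL2fun) : \pi_expL2 (f + g) = \pi_expL2 f + \pi_expL2 g.
Proof. by rewrite Quotient.pi_add. Qed.

Lemma expL2_scaleA a b u :
  expL2_scale a (expL2_scale b u) = expL2_scale (a * b) u.
Proof.
rewrite -(reprK u) (pi_expL2_scale b) (pi_expL2_scale a).
by rewrite (pi_expL2_scale (a * b)) scalerA.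
Qed.

Lemma expL2_scale1 : left_id 1 expL2_scale.
Proof. by move=> u; rewrite -(reprK u) (pi_expL2_scale 1) scale1r. Qed.

Lemma expL2_scaleDr : right_distributive expL2_scale +%R.
Proof.
move=> a u v; rewrite -(reprK u) -(reprK v) -pi_expL2D.
rewrite (pi_expL2_scale a (repr u + repr v)) (pi_expL2_scale a (repr u)).
by rewrite (pi_expL2_scale a (repr v)) scalerDr pi_expL2D.
Qed.

Lemma expL2_scaleDl u : {morph expL2_scale^~ u : a b / a + b}.
Proof.
move=> a b; rewrite -(reprK u) (pi_expL2_scale (a + b)) (pi_expL2_scale a).
by rewrite (pi_expL2_scale b) scalerDl pi_expL2D.
Qed.

HB.instance Definition _ := GRing.Zmodule_isLmodule.Build R[i] expL2
  expL2_scaleA expL2_scale1 expL2_scaleDr expL2_scaleDl.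

Definition expL2_norm (u : expL2) : R := fine (expL2fun_norm (repr u)).

Lemma expL2fun_in (f : expL2fun) : in_expLp 2%:E k f.
Proof. by apply/expL2P; case: f. Qed.

Lemma expL2_normE (f : expL2fun) : (expL2_norm (\pi_expL2 f))%:E = expL2fun_norm f.
Proof.
rewrite /expL2_norm.
rewrite (expL2fun_norm_ae _ _ (expL2_repr_pi f)) ?fineK//; try exact: expL2fun_in.
rewrite fin_numElt (lt_le_trans ltNy0) ?Lnorm_ge0//=.
by case: (expL2fun_in f).
Qed.

Lemma expL2_normD u v :
  (expL2_norm (u + v))%:C <= (expL2_norm u)%:C + (expL2_norm v)%:C.
Proof.
rewrite -rmorphD lecR -lee_fin EFinD -(reprK u) -(reprK v) -pi_expL2D.
by rewrite !expL2_normE; apply: expL2fun_normD; exact: expL2fun_in.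
Qed.

Lemma expL2_normZ (a : R[i]) u :
  (expL2_norm (a *: u))%:C = `|a| * (expL2_norm u)%:C.
Proof.
rewrite (_ : `|a| = (normc a)%:C)// -rmorphM; congr (_%:C).
apply/EFin_inj; rewrite EFinM -(reprK u).
rewrite (_ : a *: \pi_expL2 (repr u) = \pi_expL2 (a *: (repr u : expL2fun))); last exact: pi_expL2_scale.
by rewrite !expL2_normE; apply: expL2fun_normZ; exact: expL2fun_in.
Qed.

Lemma expL2_norm0_eq0 u : (expL2_norm u)%:C = 0 -> u = 0.
Proof.
move=> /complexI u0; rewrite -(reprK u) -(reprK (0 : expL2)); apply/expL2_piP.
have {}u0 : ae_eqc (repr u) 0.
  by apply: (expL2fun_norm_eq0 (expL2fun_in _)); rewrite -expL2_normE reprK u0.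
have z0 : ae_eqc (repr (0 : expL2)) 0.
  have -> : (0 : expL2) = \pi_expL2 0.
    have : \pi_expL2 0 + \pi_expL2 0 = \pi_expL2 0 by rewrite -pi_expL2D addr0.
    by move=> /(canRL (addrK _)); rewrite subrr.
  exact: expL2_repr_pi.
by apply: filterS2 u0 z0 => w -> ->.
Qed.

HB.instance Definition _ := Lmodule_isNormed.Build R[i] expL2
  expL2_normD expL2_normZ expL2_norm0_eq0.

End expL2.

Coercion expL2_fun : expL2 >-> Funclass.

Section classes.
Variables (R : realType) (n : nat).
Local Notation C := R[i]^o.
Local Notation Rn := 'rV[R]_n.
Implicit Types (k : Rn -> R) (f : Rn -> C).

(* The class of [f] in [expL2 k]; it is the zero class, and means nothing,
   when [f] does not belong to e^k L^2. *)
Definition to_expL2 k f : expL2 k :=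
  (\pi_(expL2 k) (insubd (0 : expL2fun k) f))%qT.

(* e^{s|w|} L^2 and e^{s<w>} L^2 have the same elements and equivalent norms, but
   are the distinct types [expL2 (eucl_weight s)] and [expL2 (japanese_weight s)];
   the cast identifies them. *)
Definition expL2_cast k1 k2 (u : expL2 k1) : expL2 k2 := to_expL2 k2 u.

Definition expL2_mul k1 k2 f (u : expL2 k1) : expL2 k2 :=
  to_expL2 k2 (fun w => f w * u w).

End classes.

Section smooth.
Variables (R : realType) (n : nat).
Local Notation C := R[i]^o.
Local Notation Rn := 'rV[R]_n.
Implicit Types (phi : Rn -> R) (f g : Rn -> C).

Definition partial (i : 'I_n) phi : Rn -> R :=
  fun w => 'D_(delta_mx ord0 i) phi w.

Definition partials (s : seq 'I_n) phi : Rn -> R := foldr partial phi s.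

Definition smooth phi := forall s : seq 'I_n,
  continuous (partials s phi) /\
  forall (i : 'I_n) (w : Rn), derivable (partials s phi) w (delta_mx ord0 i).

Definition test_function phi :=
  smooth phi /\ exists r : R, forall w, r < eucl w -> phi w = 0.

Definition schwartz_real phi :=
  smooth phi /\ forall (j : nat) (s : seq 'I_n),
    exists M : R, forall w, eucl w ^+ j * `|partials s phi w| <= M.

Definition schwartz f :=
  schwartz_real (fun w => Re (f w)) /\ schwartz_real (fun w => Im (f w)).

Definition multiindex m := {ffun 'I_n -> 'I_m.+1}.

Definition mlength m (a : multiindex m) : nat := \sum_i a i.

Definition mpartial m (a : multiindex m) : (Rn -> R) -> Rn -> R :=
  partials (flatten [seq nseq (a i) i | i <- enum 'I_n]).

(* [g] is the distributional derivative of order [a] of [f]. Real test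
   functions suffice by linearity, and D^a = (-i)^|a| times this derivative. *)
Definition weak_derivative m (a : multiindex m) f g :=
  forall phi, test_function phi ->
    cintegral (fun w => g w * (phi w)%:C) =
    (-1) ^+ mlength a * cintegral (fun w => f w * (mpartial a phi w)%:C).

(* The norm (sum_{|a| <= m} ||D^a u||^2)^(1/2) of e^k H^m. Weak derivatives
   being unique, the infimum is over one value if [u] is in e^k H^m; it is over
   the empty set, and the norm is +oo, otherwise. *)
Definition expHnorm m (k : Rn -> R) (u : expL2 k) : \bar R :=
  ereal_inf [set x | exists D : multiindex m -> expL2 k,
    [/\ D [ffun=> ord0] = u,
        forall a, (mlength a <= m)%N -> weak_derivative a u (D a) &
        x = (Num.sqrt (\sum_(a | (mlength a <= m)%N) expL2_norm (D a) ^+ 2))%:E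
    ]].

End smooth.

Section operators.
Variable R : realType.
Implicit Types (P X Z : normedModType R[i]) (Y : lmodType R[i]).

(* [T] has norm at most [M] from [X] to the space normed by [N]. *)
Definition opnorm_le X Y (N : Y -> \bar R) (T : X -> Y) (M : R) :=
  forall x, (N (T x) <= (M * Re `|x|)%:E)%E.

(* Complex Frechet differentiability, in operator norm, at every point of [D],
   of a family of bounded operators from [X] to the space normed by [N]. *)
Definition opnorm_holomorphic P X Y (N : Y -> \bar R) (D : set P)
    (T : P -> {linear X -> Y}) :=
  open D /\ forall p, D p ->
    (exists M, opnorm_le N (T p) M) /\
    exists dT : P -> {linear X -> Y},
      [/\ forall (a : R[i]) h1 h2 x,
            dT (a *: h1 + h2) x = a *: dT h1 x + dT h2 x,
          exists M, forall h, opnorm_le N (dT h) (M * Re `|h|) &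
          forall e : R, 0 < e -> \forall h \near (0 : P),
            opnorm_le N (fun x => T (p + h) x - T p x - dT h x) (e * Re `|h|)].

(* [differentiable] is over the scalar field R[i]: this is complex Frechet
   differentiability at every point of the open set [D]. *)
Definition analytic_on P Z (D : set P) (f : P -> Z) :=
  open D /\ forall p, D p -> differentiable f p.

Definition bounded_inverse X (A B : X -> X) :=
  [/\ linear B, continuous B, cancel A B & cancel B A].

Definition invertible_op X (A : X -> X) := exists B, bounded_inverse A B.

Definition inverse_op X (A : X -> X) : X -> X :=
  xget (fun=> 0) [set B | bounded_inverse A B].

End operators.

Notation parameters R n := (R[i]^o * 'rV[R[i]^o]_(n.-1))%type.

Section resolvents.
Variables (R : realType) (n : nat).
Local Notation C := R[i]^o.
Local Notation Rn := 'rV[R]_n.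
Implicit Types (f g h phi : Rn -> C) (rho : 'rV[R[i]]_n) (xi w : Rn).

Definition cis (t : R) : R[i] := cos t +i* sin t.

Definition fourier f : Rn -> C :=
  fun xi => cintegral (fun w => cis (- dot w xi) * f w).

Definition inverse_fourier f : Rn -> C :=
  fun w => ((2 * pi) ^- n)%:C * cintegral (fun xi => cis (dot w xi) * f xi).

(* [g] is the inverse Fourier transform of [h] as tempered distributions. *)
Definition tempered_inverse_fourier h g := forall phi, schwartz phi ->
  [/\ cintegrable (fun xi => h xi * inverse_fourier phi xi),
      cintegrable (fun w => g w * phi w) &
      cintegral (fun w => g w * phi w) =
      cintegral (fun xi => h xi * inverse_fourier phi xi)].

Definition symbol rho xi : R[i] :=
  (dot xi xi)%:C + 2 * \sum_i rho ord0 i * (xi ord0 i)%:C.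

(* [g = G_0(rho) f], for [f] integrable (such as f in e^{-s<w>} L^2, s > 0). *)
Definition is_G0 rho f g :=
  tempered_inverse_fourier (fun xi => (symbol rho xi)^-1 * fourier f xi) g.

(* An orthonormal basis of span{nu}^\perp, as the rows of a matrix: it fixes the
   identifications of span{nu}^\perp with R^{n-1} and of the complexification
   of the former with C^{n-1}. *)
Definition orthonormal_complement (nu : Rn) (Q : 'M[R]_(n.-1, n)) :=
  Q *m Q^T = 1%:M /\ Q *m nu^T = 0.

Definition rho_of (nu : Rn) (Q : 'M[R]_(n.-1, n)) (z : R[i])
    (x : 'rV[R[i]^o]_(n.-1)) : 'rV[R[i]]_n :=
  z *: map_mx (real_complex R) nu + x *m map_mx (real_complex R) Q.

Variables (g1 : R) (V : Rn -> C).

Definition G0_op :=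
  {linear expL2 (@japanese_weight R n (- g1)) ->
          expL2 (@japanese_weight R n g1)}.
Local Notation X := (expL2 (@eucl_weight R n (- g1))).

Definition id_plus_VG0 (T : G0_op) (u : X) : X :=
  u + expL2_mul _ V (T (expL2_cast _ u)).

Definition G_op (T : G0_op) (u : X) : expL2 (@japanese_weight R n g1) :=
  T (expL2_cast _ (inverse_op (id_plus_VG0 T) u)).

Definition nonreal_times (U : set 'rV[R[i]^o]_(n.-1)) :
    set (parameters R n) :=
  [set p | Im p.1 != 0 /\ U p.2].

Definition exceptional_set (U : set 'rV[R[i]^o]_(n.-1))
    (G0 : parameters R n -> G0_op) : set (parameters R n) :=
  [set p | nonreal_times U p /\ ~ invertible_op (id_plus_VG0 (G0 p))].

End resolvents.

(* Main.v *)
Require Import Defs.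
From HB Require Import structures.
From mathcomp Require Import all_boot all_order all_algebra.
From mathcomp Require Import all_classical all_reals all_analysis.
From mathcomp Require Import measurable_realfun complex.
From mathcomp Require Import ess_sup_inf ring lra.

(* With bounded multipliers J, K, L (the inclusion e^{-g1|w|} L^2 into
   e^{-g1<w>} L^2, multiplication by V, and minus the inclusion into e^{g|w|} L^2)
   one has v_p = L G0(p) J (1 + K G0(p) J)^-1 V. Where 1 + K G0(p) J is
   invertible, the Neumann series keeps it invertible nearby with inverses
   bounded uniformly, so Omega is open, and
     x(p + h) - x(p) = - B (K (G0(p + h) - G0(p)) J) x(p + h),
   for x(p) = (1 + K G0(p) J)^-1 V and B = (1 + K G0(p) J)^-1, gives the
   derivative of x and hence that of v. The Neumann series needs completeness
   of the weighted L^2 space; finally V is in e^{-g1|w|} L^2 because g1 < g0 and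
   exp (- c |w|) is integrable. *)

Set Implicit Arguments.
Unset Strict Implicit.
Unset Printing Implicit Defensive.

Import Order.TTheory GRing.Theory Num.Theory.
Import numFieldNormedType.Exports.
Import ComplexField.Normc.

Local Open Scope classical_set_scope.
Local Open Scope ring_scope.
Local Open Scope complex_scope.

(** * Analytic families of invertible operators *)

Local Notation rnorm x := (complex.Re `|x|).

Section real_norm.
Variable R : realType.
Implicit Types X Y Z P : normedModType R[i].

Lemma gt0_complexE (z : R[i]) : 0 < z -> z = (complex.Re z)%:C.
Proof.
rewrite ltcE /= => /andP[/eqP z0 _].
by apply/eqP; rewrite eq_complex /= z0 !eqxx.
Qed.

(** A nonnegative element of [R[i]] has zero imaginary part, so [rnorm] loses nothing of the
    [R[i]]-valued norm. Estimates can thus be made over the reals. *)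
Lemma rnormE X (x : X) : `|x| = (rnorm x)%:C.
Proof.
have := normr_ge0 x; rewrite lecE /= => /andP[/eqP h _].
by apply/eqP; rewrite eq_complex /= h !eqxx.
Qed.

Lemma rnorm_ge0 X (x : X) : 0 <= rnorm x.
Proof. by rewrite -lecR -rnormE normr_ge0. Qed.

Lemma rnormD X (x y : X) : rnorm (x + y) <= rnorm x + rnorm y.
Proof. by rewrite -lecR rmorphD /= -!rnormE ler_normD. Qed.

Lemma rnormN X (x : X) : rnorm (- x) = rnorm x.
Proof. by rewrite normrN. Qed.

Lemma rnorm_sum X I (r : seq I) (F : I -> X) :
  rnorm (\sum_(i <- r) F i) <= \sum_(i <- r) rnorm (F i).
Proof.
elim/big_ind2 : _ => // [|x a y b xa yb]; first by rewrite normr0.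
by rewrite (le_trans (rnormD _ _))// lerD.
Qed.

Lemma rnormB X (x y : X) : rnorm (x - y) <= rnorm x + rnorm y.
Proof. by rewrite -(rnormN y) rnormD. Qed.

Lemma rnorm_eq0 X (x : X) : rnorm x = 0 -> x = 0.
Proof. by move=> x0; apply/eqP; rewrite -normr_eq0 rnormE x0. Qed.

Lemma near0_rnorm_le P (e : R) : 0 < e -> \forall h \near (0 : P), rnorm h <= e.
Proof.
move=> e0; have e0' : 0 < e%:C by rewrite ltcR.
by apply: filterS (nbhs0_le e0') => h; rewrite rnormE lecR.
Qed.

Lemma linear_rnorm_continuous X Y (f : X -> Y) (M : R) :
  linear f -> (forall x, rnorm (f x) <= M * rnorm x) -> continuous f.
Proof.
move=> lf fM.
pose fl : {linear X -> Y} := HB.pack f (GRing.isLinear.Build _ _ _ _ f lf).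
apply: (@bounded_linear_continuous _ _ _ fl); apply/linear_boundedP.
apply: (@filterS _ _ _ (fun r => M%:C <= r)); last first.
  by apply: nbhs_pinfty_ge; rewrite complex_real.
move=> r Mr x; apply: (@le_trans _ _ (M%:C * `|x|)); last first.
  by rewrite ler_wpM2r.
by rewrite (rnormE x) (rnormE (fl x)) -rmorphM lecR fM.
Qed.

Lemma linear_continuous_rnorm X Y (f : X -> Y) :
  linear f -> continuous f ->
  exists2 M : R, 0 <= M & forall x, rnorm (f x) <= M * rnorm x.
Proof.
move=> lf cf.
pose fl : {linear X -> Y} := HB.pack f (GRing.isLinear.Build _ _ _ _ f lf).
have /linear_boundedP := (linear_bounded_continuous fl).2 cf.
move=> /pinfty_ex_gt0[M M0 fM].
have ME := gt0_complexE M0.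
exists (complex.Re M).
  by rewrite -lecR -ME ltW.
by move=> x; rewrite -lecR rmorphM /= -!rnormE -ME; exact: fM.
Qed.

Lemma analytic_differentiable P Z (f : P -> Z) (df : P -> Z) (p : P) (M : R) :
  linear df -> (forall h, rnorm (df h) <= M * rnorm h) ->
  (forall e : R, 0 < e -> \forall h \near (0 : P),
     rnorm (f (p + h) - f p - df h) <= e * rnorm h) ->
  differentiable f p.
Proof.
move=> ldf dfM fdf.
pose dfl : {linear P -> Z} := HB.pack df (GRing.isLinear.Build _ _ _ _ df ldf).
apply/diffP => /=.
(* The differential is a [get], so it inherits the required properties as soon as one candidate,
   here [dfl], has them. *)
rewrite /diff; match goal with |- context [get ?Q] => apply: (@getPex _ Q) end.
exists dfl; split; first exact: linear_rnorm_continuous ldf dfM.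
rewrite lim_id //.
suff : f = (fun y => f p + dfl (y - p)) +o_ p (fun y => y - p).
  by move=> fE; apply: eqaddoEx => y; exact: (congr1 (@^~ y) fE).
apply/eqaddoP => e e0.
have eE := gt0_complexE e0.
apply/nbhs0P; have := fdf (complex.Re e); rewrite -ltcR -eE => /(_ e0).
apply: filterS => h; rewrite !fctE /= (_ : p + h - p = h); last first.
  by rewrite addrC addKr.
by rewrite opprD addrA -lecR rmorphM /= -!rnormE -eE.
Qed.

End real_norm.

(** * Neumann series and stability of bounded inverses *)

Section neumann.
Variable R : realType.
Implicit Types X Y Z P : normedModType R[i].

(** Completeness in the form the Neumann series uses. The explicit tail bound, the sum of c / 2^j
    over j >= m, spares Cauchy filters and limits in [X]. *)
Definition geometrically_complete X := forall (d : nat -> X) (c : R),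
  (forall j, rnorm (d j) <= c / 2 ^+ j) ->
  exists x, forall m, rnorm (x - \sum_(j < m) d j) <= 2 * c / 2 ^+ m.

(** The solution is the sum of (-F)^j y. Its partial sums satisfy s_(m+1) = y - F s_m, so the
    residual x + F x - y equals (x - s_(m+1)) + F (x - s_m), which tends to 0 with m. *)
Lemma neumann X (F : X -> X) : geometrically_complete X -> linear F ->
  (forall x, rnorm (F x) <= 2^-1 * rnorm x) -> forall y, exists x, x + F x = y.
Proof.
move=> cX lF F2 y.
pose Fl : {linear X -> X} := HB.pack F (GRing.isLinear.Build _ _ _ _ F lF).
pose d j := iter j (fun x => - Fl x) y.
have dle j : rnorm (d j) <= rnorm y / 2 ^+ j.
  elim: j => [|j IH]; first by rewrite expr0 divr1.
  rewrite /d /= -/(d j) rnormN (le_trans (F2 _))//.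
  by rewrite exprS invfM mulrCA ler_pM2l ?invr_gt0.
have [x xd] := cX d _ dle.
exists x; apply/eqP; rewrite -subr_eq0; apply/eqP/rnorm_eq0/eqP.
rewrite eq_le rnorm_ge0 andbT; apply/ler_addgt0Pr => e e0; rewrite add0r.
(* The Archimedean property together with m < 2^m. *)
have [m hm] : exists m, 4 * rnorm y / 2 ^+ m <= e.
  have [m hm] : exists m, 4 * rnorm y / e <= m%:R.
    exists (Num.bound (4 * rnorm y / e)); rewrite ltW// archi_boundP//.
    by rewrite divr_ge0 ?mulr_ge0 ?rnorm_ge0// ltW.
  exists m; rewrite ler_pdivrMr ?exprn_gt0// -ler_pdivrMl// mulrC.
  by rewrite (le_trans hm)// -natrX ler_nat ltnW// ltn_expl.
apply: le_trans hm.
have dS : \sum_(j < m.+1) d j = y - Fl (\sum_(j < m) d j).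
  by rewrite big_ord_recl (raddf_sum Fl) -sumrN.
have -> : x + F x - y = (x - \sum_(j < m.+1) d j) + Fl (x - \sum_(j < m) d j).
    rewrite dS (linearB Fl) opprB -[F x]/(Fl x) -[RHS]addrA (addrC (_ - y)).
  by rewrite (addrA (_ - _)) subrK addrA.
apply: (le_trans (rnormD _ _)).
apply: (@le_trans _ _ (2 * rnorm y / 2 ^+ m.+1 + 2^-1 * (2 * rnorm y / 2 ^+ m))).
  apply: lerD; first exact: xd.
  by apply: (le_trans (F2 _)); rewrite ler_pM2l ?invr_gt0.
have y0 := rnorm_ge0 y.
have : 0 <= rnorm y / 2 ^+ m by rewrite divr_ge0 ?exprn_ge0.
rewrite exprS invfM -!mulrA; set t := rnorm y / _ => t0.
by rewrite (mulrCA (rnorm y)) -/t; lra.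
Qed.


(** One has A B0 = 1 + E with E = (A - A0) B0 of norm at most 1/2, so [neumann] makes A surjective.
    Writing x = B0 (A x - (A - A0) x) gives |x| <= 2 M |A x|, whence injectivity and the bound on
    the inverse. *)
Lemma bounded_inverse_perturbation X (A0 A B0 : X -> X) (M e : R) :
  geometrically_complete X -> linear A0 -> linear A ->
  bounded_inverse A0 B0 -> 0 <= M -> (forall x, rnorm (B0 x) <= M * rnorm x) ->
  (forall x, rnorm (A x - A0 x) <= e * rnorm x) -> 0 <= e -> e * M <= 2^-1 ->
  exists2 B, bounded_inverse A B & forall x, rnorm (B x) <= 2 * M * rnorm x.
Proof.
move=> cX lA0 lA [lB0 cB0 BA0 AB0] M0 BM AE e0 eM.
have lowA x : rnorm x <= 2 * M * rnorm (A x).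
  have : rnorm x <= M * rnorm (A x) + M * e * rnorm x.
    rewrite -[X in rnorm X <= _]BA0 (le_trans (BM _))// -mulrA -mulrDr.
    rewrite ler_wpM2l// -[A0 x](subKr (A x)) (le_trans (rnormB _ _))//.
    by rewrite lerD2l AE.
  have := ler_wpM2r (rnorm_ge0 x) eM; rewrite (mulrC e); lra.
have surA y : exists x, A x = y.
  have lE : linear (fun z => A (B0 z) - A0 (B0 z)).
    move=> a u v; rewrite lB0 lA lA0 scalerBr opprD.
    by rewrite addrACA.
  have [|z zy] := neumann cX lE _ y.
    move=> x; rewrite (le_trans (AE _))// (le_trans (ler_wpM2l e0 (BM _)))//.
    by rewrite mulrA ler_wpM2r// rnorm_ge0.
  by exists (B0 z); rewrite -zy AB0 addrC subrK.
(* Preimages are chosen pointwise; [injA] then makes the choice linear. *)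
have [B AB] := choice surA.
have BM' x : rnorm (B x) <= 2 * M * rnorm x by rewrite -{2}(AB x) lowA.
pose Al : {linear X -> X} := HB.pack A (GRing.isLinear.Build _ _ _ _ A lA).
have injA u v : A u = A v -> u = v.
  move=> uv; apply/eqP; rewrite -subr_eq0; apply/eqP/rnorm_eq0/eqP.
  rewrite eq_le rnorm_ge0 andbT (le_trans (lowA _))//.
  by rewrite -[A _]/(Al _) linearB /= uv subrr normr0 mulr0.
have lB : linear B by move=> a u v; apply: injA; rewrite lA !AB.
exists B => //; split => //.
- exact: linear_rnorm_continuous lB BM'.
- by move=> x; apply: injA; rewrite AB.
Qed.

Lemma inverse_opP X (A : X -> X) : 
  invertible_op A -> bounded_inverse A (inverse_op A).
Proof.
move=> [B AB]; apply: (@xgetPex _ _ [set B | bounded_inverse A B]).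
by exists B.
Qed.

Lemma bounded_inverse_unique X (A B1 B2 : X -> X) :
  bounded_inverse A B1 -> bounded_inverse A B2 -> B1 =1 B2.
Proof. by move=> [_ _ _ AB1] [_ _ BA2 _] x; rewrite -[LHS]BA2 AB1. Qed.

End neumann.

(** Used with a, b the values of T (p + h), T p at a moved point, c, d those at the base point and e
    the derivative: the increment of T acts on the displacement, and the remainder at the base point
    is left. *)
Lemma subrACA_split (V : zmodType) (a b c d e : V) :
  a - b - e = (a - c - (b - d)) + (c - d - e).
Proof.
rewrite opprD opprK (addrACA a) (addrC (- c)) -(opprB c d).
by rewrite addrA subrK.
Qed.

Lemma subrDD_split (V : zmodType) (a b c d e : V) :
  a - c - (d - e) = (a - b - d) + (b - c + e).
Proof.
rewrite opprB (addrAC a (- b)) -(addrA b) (addrA _ b) subrK [RHS]addrACA.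
by rewrite (addrC (- d)).
Qed.

(** * Complex differentiability of p |-> S p (1 + W p)^-1 y *)

Section analytic_inverse.
Variables (R : realType) (P X Z : normedModType R[i]) (D : set P).
Variables (S : P -> {linear X -> Z}) (W : P -> {linear X -> X}) (y : X).
Hypothesis cX : geometrically_complete X.
Hypothesis hS : opnorm_holomorphic (fun z : Z => (rnorm z)%:E) D S.
Hypothesis hW : opnorm_holomorphic (fun x : X => (rnorm x)%:E) D W.

Let A p (u : X) := u + W p u.

(** The remainder with tolerance 1 is added to the bound on [dT]. The constant uses [|M|] since
    operator bounds may be negative here. *)
Lemma opnorm_holomorphic_lipschitz (Y : normedModType R[i])
    (T : P -> {linear X -> Y}) p :
  opnorm_holomorphic (fun x : Y => (rnorm x)%:E) D T -> D p ->
  exists2 C : R, 0 <= C & \forall h \near (0 : P), forall x,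
    rnorm (T (p + h) x - T p x) <= C * rnorm h * rnorm x.
Proof.
move=> [_ /[apply]] [_ [dT [_ [M dTM] dTe]]].
exists (`|M| + 1); first by rewrite addr_ge0.
apply: filterS (dTe 1 ltr01) => h + x.
move=> /(_ x); rewrite lee_fin mul1r => h1.
have := dTM h x; rewrite lee_fin => h2.
rewrite -[X in rnorm X](subrK (dT h x)) (le_trans (rnormD _ _))//.
rewrite mulrDl mul1r mulrDl addrC lerD// (le_trans h2)//.
by rewrite !ler_wpM2r ?rnorm_ge0// ler_norm.
Qed.

Let linearA p : linear (A p).
Proof. by move=> a u v; rewrite /A linearP scalerDr addrACA. Qed.

Let opnorm_leP (Y : normedModType R[i]) (T : X -> Y) M :
  opnorm_le (fun x : Y => (rnorm x)%:E) T M <-> forall x, rnorm (T x) <= M * rnorm x.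
Proof. by split => h x; have := h x; rewrite lee_fin. Qed.

(** The Lipschitz bound makes [W (p + h) - W p] small enough for the perturbation lemma. The bound
    [2 * M] is the same for all small [h]; it later controls the moved solution. *)
Lemma invertible_near p : D p -> invertible_op (A p) ->
  exists2 M, 0 <= M & \forall h \near (0 : P), D (p + h) /\
    exists2 B, bounded_inverse (A (p + h)) B &
      forall x, rnorm (B x) <= 2 * M * rnorm x.
Proof.
move=> Dp [B0 AB0].
have [lB0 cB0 BA0 _] := AB0.
have [M M0 BM] := linear_continuous_rnorm lB0 cB0.
exists M => //.
have [C C0 hC] := opnorm_holomorphic_lipschitz hW Dp.
have oD : \forall h \near (0 : P), D (p + h).
  by have [oD _] := hW; have /nbhs0P := open_nbhs_nbhs (conj oD Dp).
(* This radius ensures C |h| M <= 1/2; the added 1 keeps it meaningful when C M = 0. *)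
have e0 : 0 < (2 * (C * M + 1))^-1.
  by rewrite invr_gt0 mulr_gt0// ltr_wpDl// mulr_ge0.
apply: filterS3 oD hC (near0_rnorm_le P e0) => h Dh hCh he; split => //.
apply: (@bounded_inverse_perturbation _ _ (A p) _ B0 M (C * rnorm h)) => //.
- move=> x; rewrite /A opprD addrACA subrr add0r; exact: hCh.
- by rewrite mulr_ge0// rnorm_ge0.
- have CM : 0 <= C * M by rewrite mulr_ge0.
  rewrite mulrAC (le_trans (ler_wpM2l CM he))// invfM mulrCA.
  rewrite ler_piMr// ler_pdivrMr ?mul1r ?lerDl// ltr_wpDl//.
Qed.

Lemma analytic_inverse :
  analytic_on (D `&` [set p | invertible_op (A p)])
    (fun p => S p (inverse_op (A p) y)).
Proof.
split.
  rewrite openE => p [Dp Ap]; apply/nbhs0P.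
  have [M _] := invertible_near Dp Ap; apply: filterS => h [Dh [B AB _]].
  by split => //; exists B.
move=> p [Dp Ap].
have [lB0 cB0 BA0 AB0] := inverse_opP Ap.
set B0 := inverse_op (A p) in lB0 cB0 BA0 AB0.
have [M0 M00 BM0] := linear_continuous_rnorm lB0 cB0.
have [M M_ge0 nearA] := invertible_near Dp Ap.
have [CW CW0 lipW] := opnorm_holomorphic_lipschitz hW Dp.
have [CS CS0 lipS] := opnorm_holomorphic_lipschitz hS Dp.
have [_ /(_ _ Dp) [_ [dW [lindW [MdW dWM] dWe]]]] := hW.
have [_ /(_ _ Dp) [[MS SM] [dS [lindS [MdS dSM] dSe]]]] := hS.
pose x0 := B0 y.
pose B0l : {linear X -> X} := HB.pack B0 (GRing.isLinear.Build _ _ _ _ B0 lB0).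
pose N := `|MS|.
have SN x : rnorm (S p x) <= N * rnorm x.
  have := SM x; rewrite lee_fin => /le_trans; apply.
  by rewrite ler_wpM2r ?rnorm_ge0// ler_norm.
have N0 : 0 <= N by rewrite normr_ge0.
(* Product rule: differentiating A(p) x(p) = y gives - B0 (dW h x0) as the derivative of x at p. *)
pose df h := dS h x0 - S p (B0 (dW h x0)).
apply: (@analytic_differentiable _ _ _ _ df p
  (MdS * rnorm x0 + N * M0 * MdW * rnorm x0)).
- move=> a h k; rewrite /df lindS lindW lB0 linearP.
  by rewrite scalerBr opprD addrACA.
- move=> h; rewrite /df (le_trans (rnormB _ _))// mulrDl lerD//.
    by have := dSM h x0; rewrite lee_fin mulrAC.
  rewrite (le_trans (SN _))// -!mulrA ler_wpM2l// (le_trans (BM0 _))//.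
  by rewrite ler_wpM2l//; have := dWM h x0; rewrite lee_fin mulrAC mulrA.
move=> e e0.
(* K |h| will bound the displacement [xh - x0]: [M0] bounds B0, [CW] is the Lipschitz constant of W,
   and [2 * M * rnorm y] bounds [xh]. *)
have [K KE] : exists K, K = M0 * CW * (2 * M * rnorm y) by eexists.
have K0 : 0 <= K by rewrite KE !mulr_ge0 ?rnorm_ge0.
(* One summand for each of the three terms into which the remainder is split below. *)
pose L := CS * K + rnorm x0 + N * M0 * (CW * K + rnorm x0).
have L0 : 0 <= L by rewrite !(addr_ge0, mulr_ge0) ?rnorm_ge0.
(* [t] serves both as a bound on |h| and as the tolerance in the differentiability of S and W. *)
have [t t0 LtE] : exists2 t, 0 < t & L * t <= e.
  exists (e / (L + 1)); first by rewrite divr_gt0// ltr_wpDl.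
  by rewrite mulrCA ler_piMr ?(ltW e0)// ler_pdivrMr ?mul1r ?lerDl// ltr_wpDl.
apply: filter_app nearA; apply: filter_app lipW; apply: filter_app lipS.
apply: filter_app (dWe t t0); apply: filter_app (dSe t t0).
apply: filterS (near0_rnorm_le P t0) => h ht.
move=> /opnorm_leP dSh /opnorm_leP dWh hS1 hW1 [Dh [B AB BM]].
have Ah : invertible_op (A (p + h)) by exists B.
have [_ _ _ ABh] := inverse_opP Ah.
set xh := inverse_op _ y.
have Axh : A (p + h) xh = y by exact: ABh.
have nxh : rnorm xh <= 2 * M * rnorm y.
  by rewrite /xh (bounded_inverse_unique (inverse_opP Ah) AB).
have rh := rnorm_ge0 h.
(* Resolvent identity: A(p + h) and A(p) differ by the increment of W, and B0 is applied to y - A(p)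
   xh. *)
have d0 : xh - x0 = - B0 (W (p + h) xh - W p xh).
  have AE : W (p + h) xh - W p xh = A (p + h) xh - A p xh.
    by rewrite /A opprD addrACA subrr add0r.
  by rewrite AE -[B0 _]/(B0l _) linearB /= BA0 Axh opprB.
have n0 : rnorm (xh - x0) <= K * rnorm h.
  rewrite d0 rnormN (le_trans (BM0 _))// KE -!mulrA ler_wpM2l//.
  rewrite (le_trans (hW1 _))// -mulrA ler_wpM2l// mulrC !mulrA.
  by rewrite ler_wpM2r.
have n1 : rnorm (xh - x0 + B0 (dW h x0)) <= M0 * (CW * K + rnorm x0) * t * rnorm h.
  rewrite d0 addrC -[B0 (dW _ _)]/(B0l _) -[B0 (_ - _)]/(B0l _) -linearB.
  rewrite (le_trans (BM0 _))// -!mulrA ler_wpM2l//.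
  rewrite -rnormN opprB.
  have -> : W (p + h) xh - W p xh - dW h x0 =
     (W (p + h) (xh - x0) - W p (xh - x0)) + (W (p + h) x0 - W p x0 - dW h x0).
    by rewrite (linearB (W (p + h))) (linearB (W p)); exact: subrACA_split.
  rewrite (le_trans (rnormD _ _))// mulrDl lerD//.
    rewrite (le_trans (hW1 _))// -!mulrA ler_wpM2l//.
    rewrite (le_trans (ler_wpM2l rh n0))// mulrCA ler_wpM2l//.
    by rewrite ler_wpM2r.
  by rewrite (le_trans (dWh _))// mulrC.
(* The increment of S on the displacement, which is quadratic in h; the remainder of S at x0; and S
   p applied to the remainder of x, estimated in [n1]. *)
have -> : S (p + h) xh - S p x0 - df h =
   (S (p + h) (xh - x0) - S p (xh - x0)) + (S (p + h) x0 - S p x0 - dS h x0)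
    + S p (xh - x0 + B0 (dW h x0)).
  rewrite (linearB (S (p + h))) (linearD (S p) (xh - x0)) (linearB (S p)).
  by rewrite -subrACA_split; exact: subrDD_split.
apply: (@le_trans _ _ (L * t * rnorm h)); last by rewrite ler_wpM2r.
rewrite (le_trans (rnormD _ _))// /L !mulrDl lerD//; last first.
  rewrite (le_trans (SN _))// -!mulrA ler_wpM2l//.
  by rewrite !mulrA.
rewrite (le_trans (rnormD _ _))// lerD//.
  rewrite (le_trans (hS1 _))// -!mulrA ler_wpM2l//.
  rewrite (le_trans (ler_wpM2l rh n0))// mulrCA ler_wpM2l//.
  by rewrite ler_wpM2r.
by rewrite (le_trans (dSh _))// mulrC mulrA.
Qed.

End analytic_inverse.

(** * Holomorphic families composed with fixed bounded operators *)

Section composition.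
Variables (R : realType) (P X0 X Z : normedModType R[i]) (Y : lmodType R[i]).
Variables (N : Y -> \bar R) (D : set P) (T : P -> {linear X -> Y}).
Variables (L : {linear Y -> Z}) (J : {linear X0 -> X}) (ML MJ : R).
Hypotheses (ML0 : 0 <= ML) (MJ0 : 0 <= MJ).
Hypothesis LN : forall y (c : R), (N y <= c%:E)%E -> rnorm (L y) <= ML * c.
Hypothesis JM : forall x, rnorm (J x) <= MJ * rnorm x.

Lemma opnorm_le_comp (F : X -> Y) (M : R) : opnorm_le N F M -> 0 <= M ->
  opnorm_le (fun z : Z => (rnorm z)%:E) (L \o F \o J) (ML * MJ * M).
Proof.
move=> FM M0 x; rewrite lee_fin /= (le_trans (LN (FM _)))// -!mulrA ler_wpM2l//.
by rewrite (mulrCA MJ) ler_wpM2l.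
Qed.

Lemma opnorm_le_norm (F : X -> Y) (M : R) : opnorm_le N F M -> opnorm_le N F `|M|.
Proof.
by move=> FM x; rewrite (le_trans (FM x))// lee_fin ler_wpM2r ?rnorm_ge0// ler_norm.
Qed.

(** The derivative of L T J is L dT J, with bounds multiplied by ML MJ. This passes from the
    extended-real [N], later the e^k H^2 norm, to the norm of a normed module. *)
Lemma opnorm_holomorphic_comp : opnorm_holomorphic N D T ->
  opnorm_holomorphic (fun z : Z => (rnorm z)%:E) D
    (fun p => (L \o T p \o J : {linear X0 -> Z})).
Proof.
move=> [oD hT]; split => // p Dp.
have [[M TM] [dT [lindT [Md dTM] dTe]]] := hT p Dp.
split.
  exists (ML * MJ * `|M|); apply: opnorm_le_comp => //.
  exact: opnorm_le_norm.
exists (fun h => L \o dT h \o J : {linear X0 -> Z}); split.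
- by move=> a h1 h2 x /=; rewrite lindT linearP.
- exists (ML * MJ * `|Md|) => h; rewrite -(mulrA (ML * MJ)).
  apply: opnorm_le_comp; last by rewrite mulr_ge0 ?rnorm_ge0.
  move=> x; rewrite (le_trans (dTM h x))// lee_fin ler_wpM2r ?rnorm_ge0//.
  by rewrite ler_wpM2r ?rnorm_ge0// ler_norm.
(* Gives ML MJ e' <= e; the added 1 keeps the divisor positive. *)
move=> e e0; pose e' := e / (ML * MJ + 1).
have MM : 0 <= ML * MJ by rewrite mulr_ge0.
have M1 : 0 < ML * MJ + 1 by rewrite ltr_wpDl.
have e'0 : 0 < e' by rewrite divr_gt0.
apply: filterS (dTe e' e'0) => h hh x.
have := opnorm_le_comp hh => /(_ _ x); rewrite !lee_fin /= !linearB.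
move=> /(_ _)/le_trans; apply; first by rewrite mulr_ge0 ?rnorm_ge0// ltW.
rewrite ler_wpM2r ?rnorm_ge0// mulrA ler_wpM2r ?rnorm_ge0//.
by rewrite /e' mulrCA ler_piMr ?(ltW e0)// ler_pdivrMr// mul1r lerDl.
Qed.

End composition.

(** * Completeness of weighted L^2 *)

Section riesz_fischer.
Variables (R : realType) (n : nat).
Local Notation C := R[i]^o.
Local Notation Rn := 'rV[R]_n.
Local Notation leb := (lebesgue_rV R n).
Implicit Types (k : Rn -> R) (f : Rn -> C) (c : R).

Lemma normr_expL2 k (u : expL2 k) : complex.Re `|u| = expL2_norm u.
Proof. by []. Qed.

Lemma expL2_norm_ge0 k (u : expL2 k) : 0 <= expL2_norm u.
Proof. by rewrite -normr_expL2 rnorm_ge0. Qed.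

Lemma measurable_sqr_normc f : cmeasurable f ->
  measurable_fun [set: Rn] (fun w => (normc (f w) ^+ 2)%:E).
Proof.
by move=> mf; apply/measurable_EFinP/measurable_funX; exact: measurable_normc.
Qed.

Lemma expL2fun_normE k f :
  expL2fun_norm k f = ((\int[leb]_w (normc (weighted k f w) ^+ 2)%:E) `^ 2^-1)%E.
Proof.
rewrite /expL2fun_norm unlock /Lnorm; congr (_ `^ _)%E.
apply: eq_integral => w _ /=.
by rewrite ger0_norm ?normc_ge0// -powR_mulrn ?normc_ge0.
Qed.

(** Removes the square root, so that norm estimates become estimates of integrals of squares. *)
Lemma expL2fun_norm_le k f c : 0 <= c ->
  ((expL2fun_norm k f <= c%:E) =
   (\int[leb]_w (normc (weighted k f w) ^+ 2)%:E <= (c ^+ 2)%:E))%E.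
Proof.
move=> c0; rewrite expL2fun_normE; set I := (\int[_]_w _)%E.
have I0 : (0 <= I)%E by apply: integral_ge0 => w _; rewrite lee_fin sqr_ge0.
have cE : (c%:E = (c ^+ 2)%:E `^ 2^-1)%E.
  by rewrite poweR_EFin -powR_mulrn// -powRrM mulfV// powRr1.
have IE : (I = (I `^ 2^-1) `^ 2)%E by rewrite -poweRrM mulVf// poweRe1.
apply/idP/idP => [h|h].
  have -> : ((c ^+ 2)%:E = c%:E `^ 2)%E by rewrite poweR_EFin -powR_mulrn.
  by rewrite IE; apply: gt0_ler_poweR; rewrite ?in_itv/= ?leey ?andbT ?poweR_ge0 ?lee_fin.
by rewrite cE; apply: gt0_ler_poweR; rewrite ?in_itv/= ?leey ?andbT ?lee_fin ?sqr_ge0.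
Qed.

Lemma geometric_half_sum c m : \sum_(j < m) c / 2 ^+ j = 2 * c - 2 * c / 2 ^+ m.
Proof.
elim: m => [|m IH]; first by rewrite big_ord0 expr0 divr1 subrr.
by rewrite big_ord_recr /= IH exprS invfM; field; rewrite expf_neq0.
Qed.

Lemma geometric_half_sum_le c m l : 0 <= c ->
  \sum_(m <= j < m + l) c / 2 ^+ j <= 2 * c / 2 ^+ m.
Proof.
move=> c0; rewrite -{1}[m]add0n big_addn addKn big_mkord.
under eq_bigr do rewrite exprD invfM mulrA.
rewrite -mulr_suml geometric_half_sum ler_wpM2r ?invr_ge0 ?exprn_ge0//.
by rewrite lerBlDr lerDl !mulr_ge0 ?invr_ge0 ?exprn_ge0.
Qed.

Lemma limn_einf_le (u : (\bar R)^nat) (b : \bar R) :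
  (forall m, u m <= b)%E -> (limn_einf u <= b)%E.
Proof.
move=> ub; rewrite limn_einf_lim; apply: lime_le; first exact: is_cvg_einfs.
apply: nearW => m; apply: le_trans (ub m); apply: ereal_inf_lbound.
by exists m => /=.
Qed.

Lemma cmeasurable_sum (f : nat -> Rn -> C) (m : nat) :
  (forall j, cmeasurable (f j)) -> cmeasurable (fun w => \sum_(j < m) f j w).
Proof.
move=> mf; elim: m => [|m IH].
  rewrite (_ : (fun _ => _) = cst 0); first by split; exact: measurable_cst.
  by apply/funext => w; rewrite big_ord0.
rewrite (_ : (fun _ => _) = (fun w => \sum_(j < m) f j w) + f m).
  exact: cmeasurableD.
by apply/funext => w; rewrite big_ord_recr.
Qed.

Lemma cmeasurableB (f g : Rn -> C) : cmeasurable f -> cmeasurable g ->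
  cmeasurable (fun w => f w - g w).
Proof.
move=> mf mg; rewrite (_ : (fun w => _) = f + (-1) *: g).
  by apply: cmeasurableD => //; exact: cmeasurableZ.
by rewrite scaleN1r.
Qed.

Lemma normc_Re (z : R[i]) : `|complex.Re z| <= normc z.
Proof.
by have := normc_ge_Re z; rewrite (_ : `|z| = (normc z)%:C)// lecR.
Qed.

Lemma normc_Im (z : R[i]) : `|complex.Im z| <= normc z.
Proof.
case: z => a b /=; rewrite -sqrtr_sqr ler_wsqrtr// lerDr sqr_ge0 //.
Qed.

(* By AM-GM, t <= 2^-j + 2^j t^2. *)
Lemma cvg_series_sqr_weighted (t : R^nat) (u : R^nat) :
  (forall j, `|u j| <= t j) ->
  (\sum_(0 <= j <oo) (2 ^+ j * t j ^+ 2)%:E < +oo)%E ->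
  cvgn (fun m => \sum_(j < m) u j).
Proof.
move=> ut tfin.
have t0 j : 0 <= t j by exact: le_trans (ut j).
have cvgt : cvgn (series (fun j => 2 ^+ j * t j ^+ 2)).
  apply: nondecreasing_is_cvgn.
    by apply/nondecreasing_series => j _ _; rewrite mulr_ge0 ?exprn_ge0// sqr_ge0.
  exists (fine (\sum_(0 <= j <oo) (2 ^+ j * t j ^+ 2)%:E)%E) => _ [m _ <-].
  rewrite -lee_fin fineK; last first.
    rewrite ge0_fin_numE// nneseries_ge0// => j _ _.
    by rewrite lee_fin mulr_ge0 ?exprn_ge0// sqr_ge0.
  rewrite /series /= -sumEFin; apply: nneseries_lim_ge => j _ _.
  by rewrite lee_fin mulr_ge0 ?exprn_ge0// sqr_ge0.
have cvg2 : cvgn (series (geometric (1 : R) 2^-1)).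
  by apply: is_cvg_geometric_series; rewrite ger0_norm ?invr_ge0// invf_lt1// ltr1n.
have : cvgn (series u).
  apply: normed_cvg; apply: (series_le_cvg _ _ _ (is_cvg_seriesD cvg2 cvgt)) => //= j.
    by rewrite addr_ge0// ?mulr_ge0 ?exprn_ge0 ?sqr_ge0 ?invr_ge0.
  apply: (le_trans (ut j)); rewrite fctE /= mul1r exprVn.
  have p0 : 0 < 2 ^+ j :> R by rewrite exprn_gt0.
  (* With s = 2^j t_j, the excess over t_j is 2^-j (s^2 - s + 1), and the square is completed. *)
  have -> : 2 ^- j + 2 ^+ j * t j ^+ 2 = t j +
      ((2 ^+ j * t j - 2^-1) ^+ 2 + 3 / 4) / 2 ^+ j.
    by field; rewrite expf_neq0.
  by rewrite lerDl divr_ge0 ?(ltW p0)// addr_ge0 ?sqr_ge0 ?divr_ge0.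
rewrite (_ : series u = fun m => \sum_(j < m) u j)//.
by apply/funext => m; rewrite /series /= big_mkord.
Qed.

(* limsup instead of lim, which makes it measurable without any convergence. *)
Definition complex_lim (s : nat -> Rn -> C) : Rn -> C := fun w =>
  (fine (limn_esup (fun m => (complex.Re (s m w))%:E)) +i*
   fine (limn_esup (fun m => (complex.Im (s m w))%:E))).

Lemma cmeasurable_complex_lim (s : nat -> Rn -> C) :
  (forall m, cmeasurable (s m)) -> cmeasurable (complex_lim s).
Proof.
move=> ms; split => /=.
- apply: (measurableT_comp (fine_measurable measurableT)).
  apply: measurable_fun_limn_esup => m; apply/measurable_EFinP.
  by case: (ms m).
- apply: (measurableT_comp (fine_measurable measurableT)).
  apply: measurable_fun_limn_esup => m; apply/measurable_EFinP.
  by case: (ms m).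
Qed.

Lemma fine_limn_esup_cvg (u : R^nat) : cvgn u ->
  fine (limn_esup (fun m => (u m)%:E)) = limn u.
Proof.
move=> cu; rewrite is_cvg_limn_esupE; first by rewrite EFin_lim.
by apply/cvg_ex; exists (limn u)%:E; apply: cvg_EFin => //; exact: nearW.
Qed.

Lemma sqr_normc (z : R[i]) :
  normc z ^+ 2 = complex.Re z ^+ 2 + complex.Im z ^+ 2.
Proof. by case: z => a b /=; rewrite sqr_sqrtr// addr_ge0 ?sqr_ge0. Qed.

(** Phrased with squared distances to a fixed [a] because these are the integrands in the
    application of Fatou's lemma. *)
Lemma cvg_complex_lim (s : nat -> Rn -> C) w (a : C) :
  cvgn (fun m => complex.Re (s m w)) -> cvgn (fun m => complex.Im (s m w)) ->
  normc (s m w - a) ^+ 2 @[m --> \oo] --> (normc (complex_lim s w - a) ^+ 2 : R).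
Proof.
move=> cRe cIm.
have ReImB (z : C) : normc (z - a) ^+ 2 =
    (complex.Re z - complex.Re a) ^+ 2 + (complex.Im z - complex.Im a) ^+ 2.
  by rewrite sqr_normc; case: z a => [? ?] [].
rewrite ReImB /= !fine_limn_esup_cvg//.
under eq_fun do rewrite ReImB.
have sqB (u : R^nat) b : cvgn u ->
    (u m - b) ^+ 2 @[m --> \oo] --> ((limn u - b) ^+ 2 : R).
  move=> cu.
  have ub : u m - b @[m --> \oo] --> (limn u - b : R).
    by apply: cvgB => //; exact: cvg_cst.
  have := cvgM ub ub => /(_ _); rewrite -expr2; apply: cvg_trans.
  by apply: near_eq_cvg; apply: nearW => m; rewrite /= expr2.
by apply: cvgD; exact: sqB.
Qed.

End riesz_fischer.

(** * The Riesz-Fischer theorem in e^k L^2 *)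

Section expL2_complete.
Variables (R : realType) (n : nat).
Local Notation C := R[i]^o.
Local Notation Rn := 'rV[R]_n.
Local Notation leb := (lebesgue_rV R n).
Variable k : Rn -> R.

Local Open Scope quotient_scope.

Lemma expL2_norm_pi_le (f : expL2fun k) (c : R) : 0 <= c ->
  (\int[leb]_w (normc (weighted k f w) ^+ 2)%:E <= (c ^+ 2)%:E)%E ->
  expL2_norm (\pi_(expL2 k) f) <= c.
Proof. by move=> c0; rewrite -expL2fun_norm_le// -expL2_normE lee_fin. Qed.

Lemma integral_sqr_expL2 (u : expL2 k) (c : R) : 0 <= c -> expL2_norm u <= c ->
  (\int[leb]_w (normc (weighted k (repr u) w) ^+ 2)%:E <= (c ^+ 2)%:E)%E.
Proof.
by move=> c0 uc; rewrite -expL2fun_norm_le// -expL2_normE reprK lee_fin.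
Qed.

Lemma pi_expL2B (f g : expL2fun k) :
  \pi_(expL2 k) (f - g) = \pi_(expL2 k) f - \pi_(expL2 k) g.
Proof. by rewrite Quotient.pi_add Quotient.pi_opp. Qed.

Lemma pi_expL2_sum (f : nat -> expL2fun k) m l :
  \pi_(expL2 k) (\sum_(m <= j < l) f j) = \sum_(m <= j < l) \pi_(expL2 k) (f j).
Proof.
elim/big_ind2 : _ => // [|f1 u f2 v <- <-]; last by rewrite pi_expL2D.
by rewrite -(subrr (0 : expL2fun k)) pi_expL2B subrr.
Qed.

Lemma expL2fun_sumE (f : nat -> expL2fun k) m l w :
  (\sum_(m <= j < l) f j : expL2fun k) w = \sum_(m <= j < l) f j w.
Proof.
by apply: (big_morph (fun h : expL2fun k => (h : Rn -> C) w)).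
Qed.

Lemma weighted_sum (f : nat -> expL2fun k) m l w :
  weighted k (\sum_(m <= j < l) f j : expL2fun k) w =
  \sum_(m <= j < l) weighted k (f j) w.
Proof. by rewrite /weighted expL2fun_sumE mulr_sumr. Qed.

(** The functions 2^j |F_j|^2 have integrals at most c^2 / 2^j, so their sum is finite almost
    everywhere and the partial sums S_m converge there to G. Fatou's lemma applied to S_(l+m) - S_m
    as l grows bounds G - S_m by the geometric tail; e^k G is the limit in the weighted space. *)
Lemma riesz_fischer : geometrically_complete (expL2 k).
Proof.
move=> d c dc.
have c0 : 0 <= c.
  by have := le_trans (rnorm_ge0 _) (dc 0%N); rewrite expr0 divr1.
have c2 j : 0 <= c / 2 ^+ j by rewrite divr_ge0 ?exprn_ge0.
pose F j := weighted k (repr (d j)).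
have mF j : cmeasurable (F j) by case: (expL2fun_in (repr (d j))).
pose S m (w : Rn) : C := \sum_(j < m) F j w.
have mS m : cmeasurable (S m) by exact: cmeasurable_sum.
pose G := complex_lim S.
have mG : cmeasurable G by exact: cmeasurable_complex_lim.
have intF j : (\int[leb]_w (2 ^+ j * normc (F j w) ^+ 2)%:E <=
    (c ^+ 2 / 2 ^+ j)%:E)%E.
  under eq_integral do rewrite EFinM.
  rewrite ge0_integralZl//; last 2 first.
  - exact: measurable_sqr_normc.
  - by move=> w _; rewrite lee_fin sqr_ge0.
  have -> : c ^+ 2 / 2 ^+ j = 2 ^+ j * (c / 2 ^+ j) ^+ 2.
    by field; rewrite expf_neq0.
  by rewrite EFinM lee_pmul2l ?lte_fin ?exprn_gt0//; exact: integral_sqr_expL2 (c2 j) (dc j).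
have mH j : measurable_fun [set: Rn] (fun w => (2 ^+ j * normc (F j w) ^+ 2)%:E).
  apply/measurable_EFinP; apply: measurable_funM => //.
  by apply: measurable_funX; exact: measurable_normc.
have H0 j w : (0 <= (2 ^+ j * normc (F j w) ^+ 2)%:E)%E.
  by rewrite lee_fin mulr_ge0 ?sqr_ge0 ?exprn_ge0.
have finH : {ae leb, forall w,
    (\sum_(0 <= j <oo) (2 ^+ j * normc (F j w) ^+ 2)%:E < +oo)%E}.
  have intH : leb.-integrable [set: Rn] (fun w =>
      (\sum_(0 <= j <oo) (2 ^+ j * normc (F j w) ^+ 2)%:E)%E).
    apply/integrableP; split.
      by apply: ge0_emeasurable_sum => // j w _ _; exact: H0.
    under eq_integral do rewrite gee0_abs ?nneseries_ge0//.
    rewrite integral_nneseries//.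
    suff h : (\sum_(0 <= j <oo) \int[leb]_w (2 ^+ j * normc (F j w) ^+ 2)%:E <=
        (2 * c ^+ 2)%:E)%E.
      exact: (le_lt_trans h (ltry _)).
    apply: lime_le.
      by apply: is_cvg_nneseries => j _ _; apply: integral_ge0 => w _; exact: H0.
    apply: nearW => m.
    apply: (@le_trans _ _ (\sum_(0 <= j < m) (c ^+ 2 / 2 ^+ j)%:E)%E).
      exact: lee_sum.
    rewrite sumEFin lee_fin -{1}[m]add0n.
    by rewrite (le_trans (geometric_half_sum_le _ _ _)) ?sqr_ge0// expr0 divr1.
  apply: filterS (integrable_ae measurableT intH) => w /(_ I).
  by rewrite ge0_fin_numE ?nneseries_ge0.
(* One null set serves for all [a], since [a] will be [S m w], which varies with w. *)
have cvgG : {ae leb, forall w, forall a : C,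
    normc (S m w - a) ^+ 2 @[m --> \oo] --> (normc (G w - a) ^+ 2 : R)}.
  apply: filterS finH => w Hw a; apply: cvg_complex_lim.
    rewrite (_ : (fun m => _) = (fun m => \sum_(j < m) complex.Re (F j w))).
      exact: (@cvg_series_sqr_weighted R (fun j => normc (F j w)) _
                (fun j => normc_Re _) Hw).
    by apply/funext => m; rewrite /S raddf_sum.
  rewrite (_ : (fun m => _) = (fun m => \sum_(j < m) complex.Im (F j w))).
    exact: (@cvg_series_sqr_weighted R (fun j => normc (F j w)) _
              (fun j => normc_Im _) Hw).
  by apply/funext => m; rewrite /S raddf_sum.
have incr m l : (\int[leb]_w (normc (S (l + m)%N w - S m w) ^+ 2)%:E <=
    ((2 * c / 2 ^+ m) ^+ 2)%:E)%E.
  pose s : expL2fun k := \sum_(m <= j < l + m) repr (d j).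
  have sE w : S (l + m)%N w - S m w = weighted k s w.
    rewrite weighted_sum /S -!(big_mkord xpredT (F^~ w)).
    by rewrite (@big_cat_nat _ _ _ m)//= ?leq_addl// addrAC subrr add0r.
  under eq_integral do rewrite sE.
  rewrite -expL2fun_norm_le ?divr_ge0 ?exprn_ge0 ?mulr_ge0// -expL2_normE lee_fin.
  rewrite /s addnC pi_expL2_sum; apply: le_trans (geometric_half_sum_le m l c0).
  rewrite -normr_expL2 (le_trans (rnorm_sum _ _))//.
  by apply: ler_sum => j _; rewrite reprK.
have tail m : (\int[leb]_w (normc (G w - S m w) ^+ 2)%:E <=
    ((2 * c / 2 ^+ m) ^+ 2)%:E)%E.
  pose g l w := (normc (S (l + m)%N w - S m w) ^+ 2)%:E.
  have mg l : measurable_fun [set: Rn] (g l).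
    by apply: measurable_sqr_normc; exact: cmeasurableB.
  (* Almost everywhere the integrand is the limit of [g l w] in l, hence its lower limit, as Fatou's
     lemma requires. *)
  rewrite (ae_eq_integral (fun w => limn_einf (g^~ w))) //.
  - apply: (le_trans (fatou _ measurableT mg _)).
      by move=> l w _; rewrite lee_fin sqr_ge0.
    by apply: limn_einf_le => l; exact: incr.
  - by apply: measurable_sqr_normc; exact: cmeasurableB.
  - rewrite /limn_einf; apply: measurableT_comp => //.
    apply: measurable_fun_limn_esup => l.
    exact: measurableT_comp (mg l).
  - apply: filterS cvgG => w /(_ (S m w)) h _.
    apply/esym/(cvg_limn_einf_sup _).1; apply: cvg_EFin; first exact: nearW.
    by move: h; rewrite -(cvg_shiftn m).
pose x0 w := (expR (k w))%:C * G w.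
have x0E : weighted k x0 = G.
  apply/funext => w; rewrite /weighted mulrA -rmorphM /= -expRD addNr expR0.
  by rewrite mul1r.
have mx : in_expLp 2%:E k x0.
  split; first by rewrite x0E.
  suff h : (expL2fun_norm k x0 <= (2 * c)%:E)%E by exact: (le_lt_trans h (ltry _)).
  (* The tail estimate at m = 0, where the partial sum is zero, is the bound on G itself. *)
  rewrite expL2fun_norm_le ?mulr_ge0// x0E; have := tail 0%N; rewrite expr0 divr1.
  by under eq_integral do rewrite /S big_ord0 subr0.
pose x : expL2fun k := ExpL2fun (introT (expL2P _ _) mx).
exists (\pi_(expL2 k) x) => m.
have -> : \sum_(j < m) d j = \pi_(expL2 k) (\sum_(0 <= j < m) repr (d j)).
  by rewrite pi_expL2_sum big_mkord; apply: eq_bigr => j _; rewrite reprK.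
rewrite -pi_expL2B normr_expL2; apply: expL2_norm_pi_le.
  by rewrite divr_ge0 ?exprn_ge0// mulr_ge0.
have E w : weighted k (x - \sum_(0 <= j < m) repr (d j)) w = G w - S m w.
  transitivity (weighted k x0 w -
      weighted k (\sum_(0 <= j < m) repr (d j) : expL2fun k) w).
    by rewrite /weighted -mulrBr.
  by rewrite x0E weighted_sum big_mkord.
by under eq_integral do rewrite E.
Qed.

End expL2_complete.

(** * Multiplication operators and weights *)

Section multiplication.
Variables (R : realType) (n : nat).
Local Notation C := R[i]^o.
Local Notation Rn := 'rV[R]_n.
Local Notation leb := (lebesgue_rV R n).
Implicit Types (k : Rn -> R) (f g : Rn -> C).

Local Open Scope quotient_scope.

Lemma expL2_eqP k (u v : expL2 k) : ae_eqc u v -> u = v.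
Proof. by move=> uv; rewrite -(reprK u) -(reprK v); apply/expL2_piP. Qed.

Lemma expL2_fun_linear k (a : R[i]) (u v : expL2 k) :
  ae_eqc (expL2_fun (a *: u + v)) (fun w => a * u w + v w).
Proof.
have -> : a *: u + v = \pi_(expL2 k) (a *: (repr u : expL2fun k) + repr v).
  by rewrite pi_expL2D -pi_expL2_scale !reprK.
exact: expL2_repr_pi.
Qed.

Lemma to_expL2_pi k f : in_expLp 2%:E k f ->
  exists2 h : expL2fun k, to_expL2 k f = \pi_(expL2 k) h & h = f :> (Rn -> C).
Proof.
move=> /expL2P Lf; exists (insubd (0 : expL2fun k) f) => //.
exact: (insubdK _ Lf).
Qed.

Lemma to_expL2_ae k f : in_expLp 2%:E k f -> ae_eqc (to_expL2 k f) f.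
Proof.
move=> /to_expL2_pi[h -> <-]; exact: expL2_repr_pi.
Qed.

Lemma to_expL2_norm k f : in_expLp 2%:E k f ->
  (expL2_norm (to_expL2 k f))%:E = expL2fun_norm k f.
Proof. by move=> /to_expL2_pi[h -> <-]; exact: expL2_normE. Qed.

Lemma in_expL2_repr k (u : expL2 k) : in_expLp 2%:E k u.
Proof. exact: expL2fun_in. Qed.

Lemma cmeasurableM f g : cmeasurable f -> cmeasurable g ->
  cmeasurable (fun w => f w * g w).
Proof.
move=> [f1 f2] [g1 g2]; split.
- rewrite (_ : (fun _ => _) =
      (fun w => complex.Re (f w) * complex.Re (g w)) \-
      (fun w => complex.Im (f w) * complex.Im (g w))).
    by apply: measurable_funB; exact: measurable_funM.
  by apply/funext => w /=; case: (f w) (g w) => [? ?] [].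
- rewrite (_ : (fun _ => _) =
      (fun w => complex.Re (f w) * complex.Im (g w)) \+
      (fun w => complex.Im (f w) * complex.Re (g w))).
    by apply: measurable_funD; exact: measurable_funM.
  by apply/funext => w /=; case: (f w) (g w) => [? ?] [].
Qed.

Lemma cmeasurable_real (r : Rn -> R) : measurable_fun [set: Rn] r ->
  cmeasurable (fun w => (r w)%:C : C).
Proof. by move=> mr; split => //; exact: measurable_cst. Qed.

Lemma cmeasurable_weighted k f : measurable_fun [set: Rn] k -> cmeasurable f ->
  cmeasurable (weighted k f).
Proof.
move=> mk mf; apply: cmeasurableM => //; apply: cmeasurable_real.
by apply: measurableT_comp => //; exact: measurableT_comp.
Qed.

Lemma weightedK k f : weighted (fun w => - k w) (weighted k f) = f.
Proof.
apply/funext => w; rewrite /weighted mulrA -rmorphM /= -expRD opprK addrN expR0.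
by rewrite mul1r.
Qed.

Section multiplier.
Variables (k1 k2 : Rn -> R) (f : Rn -> C) (M : R).
Hypothesis M0 : 0 <= M.
Hypothesis mf : cmeasurable (weighted (fun w => k2 w - k1 w) f).
Hypothesis fM : {ae leb, forall w, normc (weighted (fun w => k2 w - k1 w) f w) <= M}.

Let weighted_mul (u : Rn -> C) w : weighted k2 (fun w => f w * u w) w =
  weighted (fun w => k2 w - k1 w) f w * weighted k1 u w.
Proof.
rewrite /weighted mulrACA -rmorphM /= -expRD; congr (_%:C * _).
by congr expR; rewrite opprB addrAC subrr add0r.
Qed.

(** The weight splits by [weighted_mul]: e^(-k2) f u is the product of e^(k1 - k2) f, bounded by M
    almost everywhere, and e^(-k1) u, which is in L^2. *)
Lemma expL2fun_norm_mul u : in_expLp 2%:E k1 u ->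
  in_expLp 2%:E k2 (fun w => f w * u w) /\
  (expL2fun_norm k2 (fun w => f w * u w)%R <= M%:E * expL2fun_norm k1 u)%E.
Proof.
move=> [mu Lu].
have mfu : cmeasurable (weighted k2 (fun w => f w * u w)).
  by rewrite (funext (weighted_mul u)); exact: cmeasurableM.
have fu : (expL2fun_norm k2 (fun w => f w * u w)%R <= M%:E * expL2fun_norm k1 u)%E.
  have u0 : (0 <= expL2fun_norm k1 u)%E by exact: Lnorm_ge0.
  have ufin : expL2fun_norm k1 u \is a fin_num by rewrite ge0_fin_numE.
  rewrite -(fineK ufin) -EFinM expL2fun_norm_le ?mulr_ge0 ?fine_ge0//.
  apply: (@le_trans _ _
    (\int[leb]_w ((M ^+ 2)%:E * (normc (weighted k1 u w) ^+ 2)%:E))%E).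
    apply: ae_ge0_le_integral => //.
    - by move=> w _; rewrite lee_fin sqr_ge0.
    - exact: measurable_sqr_normc.
    - by move=> w _; rewrite -EFinM lee_fin mulr_ge0 ?sqr_ge0.
    - by apply: measurable_funeM; exact: measurable_sqr_normc.
    apply: filterS fM => w fw _.
    rewrite -EFinM lee_fin weighted_mul normcM exprMn ler_wpM2r ?sqr_ge0//.
    by rewrite lerXn2r ?nnegrE ?normc_ge0.
  rewrite ge0_integralZl//; last 3 first.
  - exact: measurable_sqr_normc.
  - by move=> w _; rewrite lee_fin sqr_ge0.
  - by rewrite lee_fin sqr_ge0.
  rewrite exprMn (EFinM (M ^+ 2)) lee_wpmul2l ?lee_fin ?sqr_ge0//.
  by rewrite -expL2fun_norm_le ?fine_ge0// fineK.
split => //; split => //.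
by rewrite (le_lt_trans fu)// lte_mul_pinfty// lee_fin.
Qed.

Lemma expL2_mul_ae (u : expL2 k1) : ae_eqc (expL2_mul k2 f u) (fun w => f w * u w).
Proof. by apply: to_expL2_ae; case: (expL2fun_norm_mul (in_expL2_repr u)). Qed.

Lemma expL2_mul_linear : linear (@expL2_mul _ _ k1 k2 f).
Proof.
move=> a u v; apply: expL2_eqP.
have h1 := expL2_fun_linear a u v.
have h2 := expL2_fun_linear a (expL2_mul k2 f u) (expL2_mul k2 f v).
have h3 : ae_eqc (expL2_fun (a *: expL2_mul k2 f u + expL2_mul k2 f v))
    (fun w => f w * (a * expL2_fun u w + expL2_fun v w)).
  apply: filterS3 h2 (expL2_mul_ae u) (expL2_mul_ae v) => w -> -> ->.
  by rewrite mulrDr mulrCA.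
by apply: filterS3 (expL2_mul_ae (a *: u + v)) h1 h3 => w -> -> ->.
Qed.

Lemma expL2_mul_norm (u : expL2 k1) :
  expL2_norm (expL2_mul k2 f u) <= M * expL2_norm u.
Proof.
have [Lfu fu] := expL2fun_norm_mul (in_expL2_repr u).
by rewrite -lee_fin to_expL2_norm// EFinM -[u in X in (_ <= _ * X)%E]reprK expL2_normE.
Qed.

Definition expL2_multiplier : {linear expL2 k1 -> expL2 k2} :=
  HB.pack (@expL2_mul _ _ k1 k2 f) (GRing.isLinear.Build _ _ _ _ _ expL2_mul_linear).

Lemma expL2_multiplier_norm (u : expL2 k1) :
  rnorm (expL2_multiplier u) <= M * rnorm u.
Proof. exact: expL2_mul_norm. Qed.

End multiplier.

(** Turns a change of weight into a multiplier, so that the inclusions and the multiplication by V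
    share one estimate. *)
Lemma expL2_castE k1 k2 (u : expL2 k1) :
  expL2_cast k2 u = expL2_mul k2 (fun=> 1) u.
Proof. by congr to_expL2; apply/funext => w; rewrite mul1r. Qed.

(** The zero multi-index contributes |u|^2 to every sum in the infimum, and the infimum over the
    empty set is +oo. Bounds in e^k H^m thus pass to e^k L^2. *)
Lemma expHnorm_ge m k (u : expL2 k) : ((expL2_norm u)%:E <= expHnorm m u)%E.
Proof.
apply: le_ereal_inf_tmp => _ [D [D0 _ ->]]; rewrite lee_fin.
have z0 : (mlength ([ffun=> ord0] : multiindex n m) <= m)%N.
  by rewrite /mlength big1// => i _; rewrite ffunE.
rewrite -[leLHS]ger0_norm ?expL2_norm_ge0// -sqrtr_sqr ler_wsqrtr//.
rewrite (bigD1 [ffun=> ord0])//= D0 lerDl sumr_ge0// => a _.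
exact: sqr_ge0.
Qed.

Lemma measurable_eucl : measurable_fun [set: Rn] (@eucl R n).
Proof.
apply: (measurableT_comp (continuous_measurable_fun (@sqrt_continuous R))).
by apply: measurable_sum => i; apply: measurable_funM; exact: measurable_rV_coord.
Qed.

Lemma measurable_japanese : measurable_fun [set: Rn] (@japanese R n).
Proof.
apply: (measurableT_comp (continuous_measurable_fun (@sqrt_continuous R))).
by apply: measurable_funD => //; apply: measurable_funX; exact: measurable_eucl.
Qed.

Lemma eucl_ge0 (w : Rn) : 0 <= eucl w.
Proof. exact: sqrtr_ge0. Qed.

Lemma japanese_le (w : Rn) : japanese w <= 1 + eucl w.
Proof.
have e0 := eucl_ge0 w.
rewrite -[leRHS]ger0_norm ?addr_ge0// -sqrtr_sqr ler_wsqrtr//.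
by rewrite sqrrD expr1n lerD2r mul1r lerDl mulrn_wge0.
Qed.

Lemma normr_coord_le (w : Rn) i : `|w ord0 i| <= eucl w.
Proof.
rewrite -sqrtr_sqr ler_wsqrtr// expr2 /dot (bigD1 i)//= lerDl sumr_ge0// => j _.
by rewrite -expr2 sqr_ge0.
Qed.

End multiplication.

(** * Integrability of exp (- c |w|) *)

Section exponential_decay.
Variable R : realType.
Local Notation Rn n := 'rV[R]_n.

(** Cubes are used in place of balls: the product structure of [lebesgue_rV] gives their volume
    directly. *)
Definition cube n (r : R) : set (Rn n) := [set w | forall i, `|w ord0 i| <= r].

Lemma measurable_cube (n : nat) (r : R) : measurable (@cube n r).
Proof.
have -> : @cube n r = \bigcap_(i in [set: 'I_n])
    (fun w : Rn n => w ord0 i) @^-1` `[- r, r].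
  apply/seteqP; split => [w h i _|w h i] /=.
    by rewrite in_itv /= -ler_norml; exact: h.
  by have := h i I; rewrite /= in_itv /= -ler_norml.
apply: fin_bigcap_measurable => //.
move=> i _; rewrite -[X in measurable X]setTI.
by apply: measurable_rV_coord => //; exact: measurable_itv.
Qed.

(** Induction on the dimension: the preimage of a cube under [consrV] is a cube times an interval.
    In dimension 0 the measure is a Dirac mass. *)
Lemma lebesgue_cube (n : nat) (r : R) : 0 <= r ->
  lebesgue_rV R n (@cube n r) = ((2 * r) ^+ n)%:E.
Proof.
move=> r0; elim: n => [|n IH].
  rewrite expr0 /= diracE mem_set//; by move=> [].
rewrite [LHS](_ : _ = (lebesgue_rV R n \x @lebesgue_measure R)%E
    (@cube n r `*` `[- r, r])).
  rewrite product_measure1E//; last exact: measurable_cube.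
  rewrite IH exprSr EFinM; congr (_ * _)%E.
  rewrite [LHS](lebesgue_measure_itv `[- r, r])/= lte_fin; case: ltP => h.
    by rewrite opprK -mulr2n mulr_natl.
  by rewrite (_ : r = 0) ?mulr0//; lra.
rewrite /= /pushforward; congr (product_measure1 _ _ _).
apply/seteqP; split => [[w t] h|[w t] [h1 h2] i] /=.
  split.
    by move=> i /=; have := h (lift ord0 i); rewrite /consrV mxE liftK.
  by have := h ord0; rewrite /consrV mxE unlift_none /= in_itv /= ler_norml.
rewrite /consrV mxE; case: (unliftP ord0 i) => [j|] _ /=; first exact: h1.
by move: h2; rewrite /= in_itv /= -ler_norml.
Qed.

(** The left side is the volume of the cube of half-side k + 1 times exp (- c k); half of the decay
    absorbs the volume and the other half leaves a geometric sequence. The absorption uses 2 (k + 1)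
    <= (2 + 2 / b) (1 + b k) and 1 + b k <= exp (b k). *)
Lemma polynomial_le_exp (n : nat) (c : R) : 0 < c -> exists2 K, 0 <= K & forall k : nat,
  (2 * k.+1%:R) ^+ n * expR (- (c * k%:R)) <= K * expR (- (c / 2)) ^+ k.
Proof.
move=> c0.
have n0 : 0 < n.+1%:R :> R by rewrite ltr0n.
(* Chosen so that exp (b k)^n <= exp (b k (n + 1)) = exp (c k / 2); dividing by n + 1 covers n =
   0. *)
have [b b0 bE] : exists2 b : R, 0 < b & b = c / 2 / n.+1%:R.
  by exists (c / 2 / n.+1%:R); rewrite // !divr_gt0.
exists ((2 + 2 / b) ^+ n); first by rewrite exprn_ge0// addr_ge0// divr_ge0// ltW.
move=> k.
rewrite -expRM_natr mulNr -ler_pdivlMr ?expR_gt0// -mulrA -expRN -expRD opprK.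
apply: (@le_trans _ _ (((2 + 2 / b) * (1 + b * k%:R)) ^+ n)).
  rewrite lerXn2r ?nnegrE ?mulr_ge0 ?addr_ge0 ?divr_ge0 ?mulr_ge0 ?(ltW b0)//.
  have -> : (2 + 2 / b) * (1 + b * k%:R) = 2 * k.+1%:R + (2 / b + 2 * b * k%:R).
    by rewrite -natr1; field; rewrite gt_eqF.
  by rewrite lerDl addr_ge0 ?divr_ge0 ?mulr_ge0 ?(ltW b0).
rewrite exprMn ler_wpM2l ?exprn_ge0 ?addr_ge0 ?divr_ge0 ?(ltW b0)//.
apply: (@le_trans _ _ (expR (b * k%:R) ^+ n)).
  by rewrite lerXn2r ?nnegrE ?addr_ge0 ?mulr_ge0 ?(ltW b0) ?expR_ge0 ?expR_ge1Dx.
rewrite -expRM_natr ler_expR.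
have -> : - (c / 2 * k%:R) + c * k%:R = b * k%:R * n.+1%:R.
  by rewrite bE; field; rewrite gt_eqF.
by rewrite ler_wpM2l ?mulr_ge0 ?(ltW b0)// ler_nat.
Qed.

(* exp (- c |w|) <= exp (- c k) on the cube of half-side k + 1, for k the integer
   part of |w|. *)
Lemma integral_exp_eucl n (c : R) : 0 < c ->
  (\int[lebesgue_rV R n]_w (expR (- (c * eucl w)))%:E < +oo)%E.
Proof.
move=> c0.
pose h (k : nat) (w : Rn n) :=
  ((expR (- (c * k%:R)))%:E * (\1_(@cube n k.+1%:R) w)%:E)%E.
have mh k : measurable_fun [set: Rn n] (h k).
  apply: measurable_funeM; apply/measurable_EFinP.
  by apply: measurable_indic; exact: measurable_cube.
have h0 k w : (0 <= h k w)%E by rewrite mule_ge0// lee_fin// expR_ge0.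
have [K K0 hK] := polynomial_le_exp n c0.
pose q := expR (- (c / 2)).
have q0 : 0 <= q by rewrite expR_ge0.
have q1 : 0 < 1 - q by rewrite subr_gt0 -expR0 ltr_expR oppr_lt0 divr_gt0.
suff b : (\int[lebesgue_rV R n]_w (expR (- (c * eucl w)))%:E <= (K / (1 - q))%:E)%E.
  exact: (le_lt_trans b (ltry _)).
apply: (@le_trans _ _ (\int[lebesgue_rV R n]_w \sum_(0 <= k <oo) h k w)%E).
  apply: ge0_le_integral => //.
  - apply/measurable_EFinP; apply: measurableT_comp => //.
    apply: measurableT_comp => //.
    by apply: measurable_funM => //; exact: measurable_eucl.
  - by apply: ge0_emeasurable_sum => // k w _ _.
  move=> w _; pose k := Num.trunc (eucl w).
  have /andP[k1 k2] : k%:R <= eucl w < k.+1%:R.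
    by apply: Num.Theory.truncn_itv; exact: eucl_ge0.
  apply: (@le_trans _ _ (h k w)).
    rewrite /h indicE mem_set; last first.
      by move=> i; rewrite (le_trans (normr_coord_le _ _))// ltW.
    by rewrite mule1 lee_fin ler_expR lerN2 ler_wpM2l// ltW.
  apply: (@le_trans _ _ (\sum_(0 <= j < k.+1) h j w)%E).
    by rewrite big_nat_recr//= leeDr// sume_ge0.
  exact: nneseries_lim_ge.
rewrite integral_nneseries//.
apply: lime_le; first by apply: is_cvg_nneseries => k _ _; exact: integral_ge0.
apply: nearW => m.
apply: (@le_trans _ _ (\sum_(0 <= k < m) (K * q ^+ k)%:E)%E).
  apply: lee_sum => k _; rewrite /h ge0_integralZl//; last first.
    by apply/measurable_EFinP; apply: measurable_indic; exact: measurable_cube.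
  rewrite integral_indic//; last exact: measurable_cube.
  rewrite setIT; apply: (@le_trans _ _ ((2 * k.+1%:R) ^+ n * expR (- (c * k%:R)))%:E).
    by rewrite [X in (_ * X)%E]lebesgue_cube// -EFinM mulrC.
  by rewrite lee_fin hK.
rewrite sumEFin lee_fin.
have := @geometric_seriesE R K q; rewrite lt_eqF; last by rewrite -subr_gt0.
move=> /(_ isT) /(congr1 (@^~ m)) /= E.
rewrite [leLHS](_ : _ = series (geometric K q) m)// E ler_wpM2r ?invr_ge0 ?(ltW q1)//.
by rewrite ler_piMr// gerBl exprn_ge0.
Qed.

End exponential_decay.

(** * From weighted L^oo bounds to weighted L^2 *)

Section weights.
Variables (R : realType) (n : nat).
Local Notation C := R[i]^o.
Local Notation Rn := 'rV[R]_n.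
Local Notation leb := (lebesgue_rV R n).

Lemma in_expLy_bound (k : Rn -> R) (f : Rn -> C) : in_expLp +oo%E k f ->
  exists2 M : R, 0 <= M & {ae leb, forall w, normc (weighted k f w) <= M}.
Proof.
move=> [_]; rewrite unlock /Lnorm; case: ifPn => [_ | + _].
  set s := ess_sup _ _ => s_lty.
  have [M sM] : exists M : R, (s <= M%:E)%E.
    by move: s_lty; case: s => // [r _|_]; [exists r|exists 0; rewrite leNye].
  exists `|M| => //; have /ess_supP := sM; apply: filterS => w /=.
  rewrite lee_fin ger0_norm ?normc_ge0// => /le_trans; apply; exact: ler_norm.
(* The norm at +oo takes the value 0 when the whole space is null; every property then holds almost
   everywhere. *)
rewrite -leNgt measure_le0 => /eqP leb0; exists 0 => //.
by exists setT; split => //; exact: measurableT.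
Qed.

Lemma normc_real (r : R) : 0 <= r -> normc r%:C = r.
Proof. by move=> r0; rewrite /= expr0n addr0 sqrtr_sqr ger0_norm. Qed.

Lemma normc_weighted (k : Rn -> R) (f : Rn -> C) w :
  normc (weighted k f w) = expR (- k w) * normc (f w).
Proof. by rewrite /weighted normcM normc_real ?expR_ge0. Qed.

Lemma measurable_eucl_weight (s : R) : measurable_fun [set: Rn] (@eucl_weight R n s).
Proof. by apply: measurable_funM => //; exact: measurable_eucl. Qed.

Lemma measurable_japanese_weight (s : R) :
  measurable_fun [set: Rn] (@japanese_weight R n s).
Proof. by apply: measurable_funM => //; exact: measurable_japanese. Qed.

Lemma cmeasurable_weightedP (k : Rn -> R) (f : Rn -> C) :
  measurable_fun [set: Rn] k -> cmeasurable (weighted k f) <-> cmeasurable f.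
Proof.
move=> mk; split => mf; last exact: cmeasurable_weighted.
by rewrite -(weightedK k f); apply: cmeasurable_weighted => //; exact: measurableT_comp.
Qed.

(** The square of e^(-t|w|) |f| is at most M^2 exp (- 2 (t - s) |w|), which is integrable. *)
Lemma expLy_sub_expL2 (s t : R) (f : Rn -> C) : s < t ->
  in_expLp +oo%E (eucl_weight s) f -> in_expLp 2%:E (eucl_weight t) f.
Proof.
move=> st Lf; have [M M0 fM] := in_expLy_bound Lf; case: Lf => mf _.
have {}mf : cmeasurable (weighted (eucl_weight t) f).
  apply/cmeasurable_weightedP; first exact: measurable_eucl_weight.
  by move/cmeasurable_weightedP : mf; apply; exact: measurable_eucl_weight.
split => //.
pose I := (\int[leb]_w (expR (- (2 * (t - s) * eucl w)))%:E)%E.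
have Ifin : (I < +oo)%E by apply: integral_exp_eucl; rewrite mulr_gt0// subr_gt0.
have I0 : (0 <= I)%E by apply: integral_ge0 => w _; rewrite lee_fin expR_ge0.
have IE : I = (fine I)%:E by rewrite fineK// ge0_fin_numE.
suff h : (expL2fun_norm (eucl_weight t) f <= (M * Num.sqrt (fine I))%:E)%E.
  exact: (le_lt_trans h (ltry _)).
rewrite expL2fun_norm_le ?mulr_ge0 ?sqrtr_ge0//.
rewrite exprMn sqr_sqrtr ?fine_ge0// (EFinM (M ^+ 2)) -IE /I.
have mexp : measurable_fun [set: Rn] (fun w => (expR (- (2 * (t - s) * eucl w)))%:E).
  apply/measurable_EFinP; apply: measurableT_comp => //; apply: measurableT_comp => //.
  by apply: measurable_funM => //; exact: measurable_eucl.
rewrite -ge0_integralZl// ?lee_fin ?sqr_ge0//.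
apply: ae_ge0_le_integral => //.
- by move=> w _; rewrite lee_fin sqr_ge0.
- exact: measurable_sqr_normc.
- by move=> w _; rewrite -EFinM lee_fin mulr_ge0 ?sqr_ge0 ?expR_ge0.
- exact: measurable_funeM.
apply: filterS fM => w fw _; rewrite -EFinM lee_fin.
have -> : normc (weighted (eucl_weight t) f w) =
    normc (weighted (eucl_weight s) f w) * expR (- ((t - s) * eucl w)).
  rewrite !normc_weighted mulrAC -expRD; congr (expR _ * _).
  by rewrite /eucl_weight; ring.
rewrite exprMn; apply: ler_pM; rewrite ?sqr_ge0//.
  by rewrite lerXn2r ?nnegrE ?normc_ge0.
by rewrite -expRM_natr ler_expR; lra.
Qed.

End weights.

(** * Analyticity of v *)

Theorem proposition2p5 (R : realType) (n : nat) (hn : (3 <= n)%N)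
    (nu : 'rV[R]_n) (hnu : eucl nu = 1)
    (Q : 'M[R]_(n.-1, n)) (hQ : orthonormal_complement nu Q)
    (g0 : R) (hg0 : 0 < g0)
    (V : 'rV[R]_n -> R[i]^o) (hV : in_expLp +oo%E (eucl_weight (- g0)) V)
    (g : R) (hg : 0 < g)
    (g1 : R) (hg1 : 0 < g1) (hg1g : g1 <= g) (hg1g0 : 2 * g1 < g0)
    (U : set 'rV[R[i]^o]_(n.-1)) (hUo : open U)
    (hU : forall x : 'rV[R]_(n.-1), x != 0 -> U (map_mx (real_complex R) x))
    (G0 : parameters R n -> G0_op n g1)
    (hG0 : opnorm_holomorphic (@expHnorm R n 2 (japanese_weight g1))
       (nonreal_times U) G0)
    (hG0E : forall (z : R[i]) (x : 'rV[R]_(n.-1)),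
       complex.Im z != 0 -> x != 0 ->
       forall f : expL2 (japanese_weight (- g1)),
         is_G0 (rho_of nu Q z (map_mx (real_complex R) x))
           f (expL2_fun (G0 (z, map_mx (real_complex R) x) f))) :
  let Omega := nonreal_times U `\` exceptional_set V U G0 in
  exists (Vc : expL2 (@eucl_weight R n (- g1)))
         (v : parameters R n -> expL2 (@eucl_weight R n g)),
    [/\ ae_eqc Vc V,
        forall p, Omega p -> ae_eqc (v p) (fun w => - G_op V (G0 p) Vc w) &
        analytic_on Omega v].
Proof.
move=> Omega.
have LV : in_expLp 2%:E (eucl_weight (- g1)) V.
  by apply: expLy_sub_expL2 hV; lra.
pose Vc := to_expL2 (@eucl_weight R n (- g1)) V.
have [MV MV0 VM] := in_expLy_bound hV.
have mV : cmeasurable V.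
  by case: hV => /cmeasurable_weightedP + _; apply; exact: measurable_eucl_weight.
have mc (a : R[i]) : cmeasurable (fun _ : 'rV[R]_n => a : R[i]^o).
  by split; exact: measurable_cst.
have g1M : 0 <= expR g1 by exact: expR_ge0.
have jw (w : 'rV[R]_n) : g1 * japanese w <= g1 * (1 + eucl w).
  by rewrite ler_wpM2l ?(ltW hg1)// japanese_le.
have mdiff (k1 k2 : 'rV[R]_n -> R) f : measurable_fun setT k1 ->
    measurable_fun setT k2 -> cmeasurable f ->
    cmeasurable (weighted (fun w => k2 w - k1 w) f).
  by move=> m1 m2 mf; apply: cmeasurable_weighted => //; exact: measurable_funB.
have me := @measurable_eucl_weight R n; have mj := @measurable_japanese_weight R n.
(* <w> <= 1 + |w| costs a factor e^g1 in each of the three multipliers. *)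
have bJ : {ae lebesgue_rV R n, forall w, normc (weighted (fun w =>
    japanese_weight (- g1) w - eucl_weight (- g1) w) (fun=> 1) w) <= expR g1}.
  apply: nearW => w; rewrite normc_weighted normc_real// mulr1 ler_expR.
  by rewrite /japanese_weight /eucl_weight; have := jw w; lra.
have bL : {ae lebesgue_rV R n, forall w, normc (weighted (fun w =>
    eucl_weight g w - japanese_weight g1 w) (fun=> -1) w) <= expR g1}.
  apply: nearW => w; rewrite normc_weighted normcN normc_real// mulr1 ler_expR.
  (* With g1 <= g, the exponent g1 <w> - g |w| is at most g1. *)
  have := ler_wpM2r (eucl_ge0 w) hg1g.
  by rewrite /japanese_weight /eucl_weight; have := jw w; lra.
have bV : {ae lebesgue_rV R n, forall w, normc (weighted (fun w =>
    eucl_weight (- g1) w - japanese_weight g1 w) V w) <= expR g1 * MV}.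
  apply: filterS VM => w; rewrite !normc_weighted => VMw.
  apply: le_trans (ler_wpM2l g1M VMw).
  (* Passing from growth e^(g1 <w>) to decay e^(-g1 |w|) costs g1 <w> + g1 |w| <= g1 + 2 g1 |w|,
     which the decay of V pays for as 2 g1 < g0. *)
  rewrite mulrA -expRD ler_wpM2r ?normc_ge0// ler_expR.
  have := ler_wpM2r (eucl_ge0 w) (ltW hg1g0).
  by rewrite /japanese_weight /eucl_weight; have := jw w; lra.
have MgV : 0 <= expR g1 * MV by rewrite mulr_ge0.
have mJ := mdiff _ _ _ (me (- g1)) (mj (- g1)) (mc 1).
have mL := mdiff _ _ _ (mj g1) (me g) (mc (-1)).
have mK := mdiff _ _ _ (mj g1) (me (- g1)) mV.
pose J := expL2_multiplier g1M mJ bJ.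
pose L := expL2_multiplier g1M mL bL.
pose K := expL2_multiplier MgV mK bV.
have JM x : rnorm (J x) <= expR g1 * rnorm x.
  exact: (expL2_multiplier_norm g1M mJ bJ).
have LN y (c : R) : (expHnorm 2 y <= c%:E)%E -> rnorm (L y) <= expR g1 * c.
  move=> yc; rewrite (le_trans (expL2_multiplier_norm g1M mL bL y))//.
  by rewrite ler_wpM2l// -lee_fin (le_trans (expHnorm_ge 2 y) yc).
have KN y (c : R) : (expHnorm 2 y <= c%:E)%E -> rnorm (K y) <= expR g1 * MV * c.
  move=> yc; rewrite (le_trans (expL2_multiplier_norm MgV mK bV y))//.
  by rewrite ler_wpM2l// -lee_fin (le_trans (expHnorm_ge 2 y) yc).
have hS := opnorm_holomorphic_comp g1M g1M LN JM hG0.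
have hW := opnorm_holomorphic_comp MgV g1M KN JM hG0.
have idE p : id_plus_VG0 V (G0 p) = fun u => u + K (G0 p (J u)).
  by apply/funext => u; rewrite /id_plus_VG0 expL2_castE.
(* The minus sign of v is carried by [L], the multiplier by -1. *)
exists Vc,
  (fun p => L (G0 p (J (inverse_op (fun u => u + K (G0 p (J u))) Vc)))).
split.
- exact: to_expL2_ae.
- move=> p _; rewrite /G_op idE expL2_castE.
  set x := inverse_op _ _.
  apply: filterS (expL2_mul_ae g1M mL bL (G0 p (J x))) => w ->.
  by rewrite mulN1r.
have -> : Omega = nonreal_times U `&`
    [set p | invertible_op (fun u => u + K (G0 p (J u)))].
  apply/seteqP; split => p [Dp].
    by move=> /not_andP[//|/contrapT]; rewrite idE.
  by move=> inv; split => // -[_]; apply; rewrite idE.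
exact: (analytic_inverse Vc (@riesz_fischer _ _ _) hS hW).
Qed.
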